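(* Let $\alpha,\beta,\gamma,\delta\in F^\times$ and $c_1,c_2\in\mathfrak o^\times$. Then $J_0(d_{\alpha,\beta}f^\pm_{\rm min},d_{\gamma,\delta}f^\pm_{\rm min})=0$ unless all of the following conditions are satisfied: $$\frac\alpha\gamma,\ \frac\beta\delta\in1+\mathfrak p,\qquad\gamma\in\varpi^{-1}c_1^{-1}(1+\mathfrak p),\qquad\delta\in\varpi^{-1}c_2^{-1}(1+\mathfrak p).$$ If all these conditions are satisfied, then $J_0(d_{\alpha,\beta}f^\pm_{\rm min},d_{\gamma,\delta}f^\pm_{\rm min})=q^7$. In particular, $J_0(d_{\varpi^{-1}c_1^{-1},\varpi^{-1}c_2^{-1}}f^\pm_{\rm min})=q^7$.
   Context: $F$ is a non-archimedean local field of characteristic zero with ring of integers $\mathfrak o$, maximal ideal $\mathfrak p$, uniformizer $\varpi$, $q=\#(\mathfrak o/\mathfrak p)$. $\psi$ is a character of $F$ trivial on $\mathfrak o$ but not on $\mathfrak p^{-1}$, and $\psi_0(x)=\psi(\varpi^{-1}x)$. The Haar measure on $F$ gives $\mathfrak o$ volume $1$. $G=\mathrm{GSp}_4(F)=\{g\in\mathrm{GL}_4(F):{}^tgJg=\mu(g)J,\ \mu(g)\in F^\times\}$ with $J=\begin{bmatrix}&&&1\\&&1\\&-1\\-1\end{bmatrix}$; $Z$ is its center. Let $K'=G\cap\begin{bmatrix}1+\mathfrak p&\mathfrak o&\mathfrak o&\mathfrak o\\\mathfrak p&1+\mathfrak p&\mathfrak o&\mathfrak o\\\mathfrak p&\mathfrak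 p&1+\mathfrak p&\mathfrak o\\\mathfrak p&\mathfrak p&\mathfrak p&1+\mathfrak p\end{bmatrix}$ and $H=ZK'$. For a fixed $t\in\mathfrak o^\times$, $\chi=\chi_{1,1,t}:H\to\mathbb C^\times$ is $\chi(zk)=\psi_0(k_{12}+k_{23}+t\varpi^{-1}k_{41})$ for $z\in Z$, $k\in K'$. Let $g_\chi=\begin{bmatrix}0&0&1&0\\0&0&0&-1\\-\varpi/t&0&0&0\\0&\varpi/t&0&0\end{bmatrix}$, $H'=H\sqcup g_\chi H$, and $\chi^\pm:H'\to\mathbb C^\times$, $\chi^\pm(h)=\chi(h)$, $\chi^\pm(g_\chi h)=\pm\chi(h)$ for $h\in H$. Then $\sigma_\chi^\pm=\text{c-Ind}_{H'}^G(\chi^\pm)$, realized on functions $f:G\to\mathbb C$ with $f(hg)=\chi^\pm(h)f(g)$ for $h\in H'$, with $G$ acting by right translation; $gf$ denotes the action of $g\in G$ on $f$. The minimal vector $f^\pm_{\rm min}\in\sigma_\chi^\pm$ equals $\chi^\pm$ on $H'$ and zero outside $H'$. The inner product is $\langle f_1,f_2\rangle=\mathrm{vol}(Z\backslash H')^{-1}\int_{Z\backslash G}f_1(x)\overline{f_2(x)}\,dx$, so that $\langle f^\pm_{\rm min},f^\pm_{\rm min}\rangle=1$. For $\alpha,\beta\in F^\times$, $d_{\alpha,\beta}=\mathrm{diag}(\alpha^2\beta,\alpha\beta,\alpha,1)$. $U$ is the group of matrices $u(a,b,c,e)=\begin{bmatrix}1&a\\&1\\&&1&-a\\&&&1\end{bmatrix}\begin{bmatrix}1&&b&c\\&1&e&b\\&&1\\&&&1\end{bmatrix}$,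 $a,b,c,e\in F$, with measure $da\,db\,dc\,de$, and $\psi_{c_1,c_2}(u(a,b,c,e))=\psi(c_1a+c_2e)$. For vectors $v_1,v_2$ in $\sigma_\chi^\pm$ put $J_0(v_1,v_2)=\int_U\langle uv_1,v_2\rangle\psi_{c_1,c_2}^{-1}(u)\,du$ (absolutely convergent), and for $v\ne0$ put $J_0(v)=J_0(v,v)/\langle v,v\rangle$. *)

(* Defs.v *)
From HB Require Import structures.
From mathcomp Require Import all_boot all_order all_algebra generic_quotient.
From mathcomp Require Import finmap complex ring.
From mathcomp Require Import all_classical all_reals all_analysis.

Set Implicit Arguments.
Unset Strict Implicit.
Unset Printing Implicit Defensive.

Import Order.TTheory GRing.Theory Num.Theory.

Local Open Scope classical_set_scope.
Local Open Scope ring_scope.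
Local Open Scope quotient_scope.

(* The fractional ideal [p ^ n], [n : int]; the value of [v] at 0 is junk. *)
Definition vball (F : fieldType) (v : F -> int) (n : int) : set F :=
  [set x | x = 0 \/ n <= v x].

Definition vcosets (F : fieldType) (v : F -> int) : set (set F) :=
  [set [set x + y | y in vball v 1] | x in vball v 0].

(* Non-archimedean local fields of characteristic zero: fields complete for a
   normalized discrete valuation with finite residue field, together with the
   valuation topology. *)
HB.mixin Record isNALocalField F & GRing.Field F & Topological F := {
  lval : F -> int;
  lvalM : forall x y : F, x != 0 -> y != 0 -> lval (x * y) = lval x + lval y;
  lvalD : forall x y : F, x != 0 -> y != 0 -> x + y != 0 ->
    Num.min (lval x) (lval y) <= lval (x + y);
  lval_surj : exists2 x : F, x != 0 & lval x = 1;
  lval_nbhs : forall (x : F) (A : set F),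
    nbhs x A <-> exists n : int, [set x + y | y in vball lval n] `<=` A;
  lval_complete : forall w : nat -> F,
    (forall n : int, exists N : nat, forall i j : nat,
      (N <= i)%N -> (N <= j)%N -> vball lval n (w i - w j)) ->
    exists l : F, w @ \oo --> l;
  lval_finite : finite_set (vcosets lval);
  lfield_char0 : [pchar F] =i pred0
}.

#[short(type="naLocalFieldType")]
HB.structure Definition NALocalField :=
  {F of isNALocalField F & GRing.Field F & Topological F}.

Section LocalField.
Variable F : naLocalFieldType.

Definition pideal (n : int) : set F := vball lval n.
Definition lint : set F := pideal 0.
Definition lmax : set F := pideal 1.
Definition lunit : set F := [set x | x != 0 /\ lval x = 0].
(* 1 + p *)
Definition lunit1 : set F := [set 1 + y | y in lmax].
Definition is_uniformizer (w : F) : Prop := w != 0 /\ lval w = 1.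

(* q = #(o / p) *)
Definition residue_card : nat := #|` fset_set (vcosets (@lval F))|.

End LocalField.

Arguments lint {F}.
Arguments lmax {F}.
Arguments lunit {F}.
Arguments lunit1 {F}.

(* Homomorphisms F -> C^* trivial on o but not on p^-1. Triviality on the open
   subgroup o makes them continuous. *)
Definition is_character (F : naLocalFieldType) (R : realType)
    (psi : F -> R[i]) : Prop :=
  [/\ forall x, psi x != 0,
      forall x y, psi (x + y) = psi x * psi y,
      forall x, lint x -> psi x = 1
    & exists2 x, pideal (-1) x & psi x != 1].

Section J4Def.
Variable F : fieldType.

Definition mx4 (s : seq (seq F)) : 'M[F]_4 :=
  \matrix_(i < 4, j < 4) nth 0 (nth [::] s i) j.

Lemma mx4T
  (a00 a01 a02 a03 a10 a11 a12 a13 a20 a21 a22 a23 a30 a31 a32 a33 : F) :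
  (mx4 [:: [:: a00; a01; a02; a03];
         [:: a10; a11; a12; a13];
         [:: a20; a21; a22; a23];
         [:: a30; a31; a32; a33]])^T =
  mx4 [:: [:: a00; a10; a20; a30];
        [:: a01; a11; a21; a31];
        [:: a02; a12; a22; a32];
        [:: a03; a13; a23; a33]].
Proof.
by apply/matrixP; case=> [[|[|[|[|//]]]] ?]; case=> [[|[|[|[|//]]]] ?];
  rewrite !mxE.
Qed.

Lemma mx4M
  (a00 a01 a02 a03 a10 a11 a12 a13 a20 a21 a22 a23 a30 a31 a32 a33
   b00 b01 b02 b03 b10 b11 b12 b13 b20 b21 b22 b23 b30 b31 b32 b33 : F) :
  mx4 [:: [:: a00; a01; a02; a03];
        [:: a10; a11; a12; a13];
        [:: a20; a21; a22; a23];
        [:: a30; a31; a32; a33]] *m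
  mx4 [:: [:: b00; b01; b02; b03];
        [:: b10; b11; b12; b13];
        [:: b20; b21; b22; b23];
        [:: b30; b31; b32; b33]] =
  mx4 [:: [:: a00 * b00 + a01 * b10 + a02 * b20 + a03 * b30;
            a00 * b01 + a01 * b11 + a02 * b21 + a03 * b31;
            a00 * b02 + a01 * b12 + a02 * b22 + a03 * b32;
            a00 * b03 + a01 * b13 + a02 * b23 + a03 * b33];
        [:: a10 * b00 + a11 * b10 + a12 * b20 + a13 * b30;
            a10 * b01 + a11 * b11 + a12 * b21 + a13 * b31;
            a10 * b02 + a11 * b12 + a12 * b22 + a13 * b32;
            a10 * b03 + a11 * b13 + a12 * b23 + a13 * b33];
        [:: a20 * b00 + a21 * b10 + a22 * b20 + a23 * b30;
            a20 * b01 + a21 * b11 + a22 * b21 + a23 * b31;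
            a20 * b02 + a21 * b12 + a22 * b22 + a23 * b32;
            a20 * b03 + a21 * b13 + a22 * b23 + a23 * b33];
        [:: a30 * b00 + a31 * b10 + a32 * b20 + a33 * b30;
            a30 * b01 + a31 * b11 + a32 * b21 + a33 * b31;
            a30 * b02 + a31 * b12 + a32 * b22 + a33 * b32;
            a30 * b03 + a31 * b13 + a32 * b23 + a33 * b33]].
Proof.
apply/matrixP; case=> [[|[|[|[|//]]]] ?]; case=> [[|[|[|[|//]]]] ?];
  by rewrite mxE !big_ord_recl big_ord0 !mxE /= addr0 !addrA.
Qed.

Lemma mx4Z (m : F)
  (a00 a01 a02 a03 a10 a11 a12 a13 a20 a21 a22 a23 a30 a31 a32 a33 : F) :
  m *: mx4 [:: [:: a00; a01; a02; a03];
              [:: a10; a11; a12; a13];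
              [:: a20; a21; a22; a23];
              [:: a30; a31; a32; a33]] =
  mx4 [:: [:: m * a00; m * a01; m * a02; m * a03];
        [:: m * a10; m * a11; m * a12; m * a13];
        [:: m * a20; m * a21; m * a22; m * a23];
        [:: m * a30; m * a31; m * a32; m * a33]].
Proof.
by apply/matrixP; case=> [[|[|[|[|//]]]] ?]; case=> [[|[|[|[|//]]]] ?];
  rewrite !mxE.
Qed.

Definition J4 : 'M[F]_4 :=
  mx4 [:: [:: 0;   0;  0; 1];
          [:: 0;   0;  1; 0];
          [:: 0; - 1;  0; 0];
          [:: - 1; 0;  0; 0]].

End J4Def.

Ltac mx4_ring :=
  rewrite /J4 ?mx4T ?mx4M ?mx4M ?mx4Z;
  do ?[congr mx4 | congr cons]; ring.

Section GSp4Def.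
Variable F : fieldType.

Definition gsp4_pred : pred 'M[F]_4 := fun g =>
  (g \in unitmx) && `[< exists2 m : F, m != 0 & g^T *m J4 F *m g = m *: J4 F >].

Record GSp4 := MkGSp4 { gval :> 'M[F]_4; _ : gsp4_pred gval }.

HB.instance Definition _ := [isSub for gval].
HB.instance Definition _ := [Choice of GSp4 by <:].

Lemma gsp4_1 : gsp4_pred 1%:M.
Proof.
rewrite /gsp4_pred unitmx1; apply/asboolP; exists 1; first exact: oner_neq0.
by rewrite trmx1 mul1mx mulmx1 scale1r.
Qed.

Lemma gsp4_mul g h : gsp4_pred g -> gsp4_pred h -> gsp4_pred (g *m h).
Proof.
move=> /andP[ug /asboolP[m m0 gE]] /andP[uh /asboolP[l l0 hE]].
rewrite /gsp4_pred unitmx_mul ug uh; apply/asboolP; exists (m * l).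
  by rewrite mulf_neq0.
have -> : (g *m h)^T *m J4 F *m (g *m h) = h^T *m (g^T *m J4 F *m g) *m h.
  by rewrite trmx_mul !mulmxA.
by rewrite gE -scalemxAr -scalemxAl hE scalerA.
Qed.

Lemma gsp4_inv g : gsp4_pred g -> gsp4_pred (invmx g).
Proof.
move=> /andP[ug /asboolP[m m0 gE]].
rewrite /gsp4_pred unitmx_inv ug; apply/asboolP; exists m^-1.
  by rewrite invr_neq0.
apply: (scalerI m0); rewrite scalerA divff// scale1r.
rewrite scalemxAl scalemxAr -gE !mulmxA -trmx_mul mulmxV//.
by rewrite trmx1 mul1mx -mulmxA mulmxV// mulmx1.
Qed.

Definition gsp_one := MkGSp4 gsp4_1.
Definition gsp_mul (g h : GSp4) := MkGSp4 (gsp4_mul (valP g) (valP h)).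
Definition gsp_inv (g : GSp4) := MkGSp4 (gsp4_inv (valP g)).

Lemma gsp_unit (g : GSp4) : gval g \in unitmx.
Proof. by case: g => g /= /andP[]. Qed.

Lemma gsp_mulA : associative gsp_mul.
Proof. by move=> x y z; apply/val_inj; exact: mulmxA. Qed.
Lemma gsp_mul1 : left_id gsp_one gsp_mul.
Proof. by move=> x; apply/val_inj; exact: mul1mx. Qed.
Lemma gsp_mulr1 : right_id gsp_one gsp_mul.
Proof. by move=> x; apply/val_inj; exact: mulmx1. Qed.
Lemma gsp_mulV : left_inverse gsp_one gsp_inv gsp_mul.
Proof. by move=> x; apply/val_inj; exact/mulVmx/gsp_unit. Qed.
Lemma gsp_mulrV : right_inverse gsp_one gsp_inv gsp_mul.
Proof. by move=> x; apply/val_inj; exact/mulmxV/gsp_unit. Qed.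

HB.instance Definition _ := isGroup.Build GSp4
  gsp_mulA gsp_mul1 gsp_mulr1 gsp_mulV gsp_mulrV.
HB.instance Definition _ := isPointed.Build GSp4 gsp_one.

(* Matrices outside of GSp4 are sent to 1; [gchiE], [dmatE] and [umatE] below
   show that this does not happen where [toGSp4] is used. *)
Definition toGSp4 (g : 'M[F]_4) : GSp4 := insubd gsp_one g.

Lemma toGSp4E (m : F) (g : 'M[F]_4) :
  m != 0 -> g^T *m J4 F *m g = m *: J4 F -> gval (toGSp4 g) = g.
Proof.
move=> m0 gE; apply: insubdK; rewrite unfold_in /gsp4_pred.
apply/andP; split; last by apply/asboolP; exists m.
suff : m *: J4 F \in unitmx by rewrite -gE unitmx_mul => /andP[].
rewrite unitmxZ ?unitfE//; suff : J4 F *m (-1 *: J4 F) = 1%:M.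
  by case/mulmx1_unit.
have -> : 1%:M = mx4 (F := F) [:: [:: 1; 0; 0; 0]; [:: 0; 1; 0; 0];
                         [:: 0; 0; 1; 0]; [:: 0; 0; 0; 1]].
  by apply/matrixP; case=> [[|[|[|[|//]]]] ?]; case=> [[|[|[|[|//]]]] ?];
    rewrite !mxE.
rewrite /J4 mx4Z; mx4_ring.
Qed.

Definition Zc : set GSp4 := [set z | forall g, (z * g = g * z)%g].

Definition zrel (x y : GSp4) : bool := `[< exists2 z, Zc z & x = (z * y)%g >].

Lemma zrel_refl : reflexive zrel.
Proof.
by move=> x; apply/asboolP; exists 1%g; rewrite ?mul1g// => g;
  rewrite mul1g mulg1.
Qed.

Lemma zrel_sym : symmetric zrel.
Proof.
suff sym x y : zrel x y -> zrel y x by move=> x y; apply/idP/idP; exact: sym.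
move=> /asboolP[z Zz ->]; apply/asboolP; exists z^-1%g; last by rewrite mulKg.
by move=> g; apply: (mulgI z); rewrite mulVKg [RHS]mulgA Zz mulgK.
Qed.

Lemma zrel_trans : transitive zrel.
Proof.
move=> y x z /asboolP[a Za ->] /asboolP[b Zb ->]; apply/asboolP.
exists (a * b)%g; last exact: mulgA.
by move=> g; rewrite -mulgA Zb !mulgA Za.
Qed.

Canonical zrel_equiv := EquivRel zrel zrel_refl zrel_sym zrel_trans.

End GSp4Def.

HB.instance Definition _ (F : naLocalFieldType) :=
  Topological.copy (GSp4 F) (initial_topology (@gval F)).

(* Z \ G, with the quotient topology *)
Definition ZG (F : naLocalFieldType) :=
  quotient_topology {eq_quot (@zrel_equiv F)}.
HB.instance Definition _ (F : naLocalFieldType) :=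
  PointedTopological.on (ZG F).
HB.instance Definition _ (F : naLocalFieldType) := Quotient.on (ZG F).

Definition borel (T : ptopologicalType) := g_sigma_algebraType (@open T).
HB.instance Definition _ (T : ptopologicalType) := Measurable.on (borel T).

(* [F] pointed at 0, as measurable types must be pointed *)
Definition pointed_lfield (F : naLocalFieldType) : Type := F.
HB.instance Definition _ (F : naLocalFieldType) :=
  Topological.on (pointed_lfield F).
HB.instance Definition _ (F : naLocalFieldType) :=
  isPointed.Build (pointed_lfield F) (0 : F).

Definition borelF (F : naLocalFieldType) := borel (pointed_lfield F).
HB.instance Definition _ (F : naLocalFieldType) := Measurable.on (borelF F).

(* Nonzero Radon measure on [T] invariant under the maps [act g]. *)
Definition is_haar (R : realType) (G : Type) (T : ptopologicalType)
    (act : G -> T -> T) (m : set (borel T) -> \bar R) : Prop :=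
  [/\ forall g (A : set (borel T)), measurable A -> m (act g @^-1` A) = m A,
      forall K : set T, compact K -> (m K < +oo)%E
    & forall V : set T, open V -> V !=set0 -> (0 < m V)%E].

(* Integral of a complex-valued function *)
Definition cintegral d (T : measurableType d) (R : realType)
    (m : {measure set T -> \bar R}) (f : T -> R[i]) : R[i] :=
  Complex (\int[m]_(x in setT) complex.Re (f x))
          (\int[m]_(x in setT) complex.Im (f x)).

Section Representation.
Variables (F : naLocalFieldType) (R : realType).
Local Notation G := (GSp4 F).

Definition ZGtrans (g : G) (y : ZG F) : ZG F := \pi_(ZG F) (repr y * g)%g.

Variables (psi : F -> R[i]) (w t : F) (s : bool).

Definition psi0 (x : F) : R[i] := psi (w^-1 * x).

Definition Kp : set G := [set k | forall i j : 'I_4,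
  if (i < j)%N then lint (gval k i j)
  else if i == j then lunit1 (gval k i j) else lmax (gval k i j)].

Definition Hgrp : set G := [set (z * k)%g | z in @Zc F & k in Kp].

Definition chi (h : G) : R[i] :=
  let k := (xget (1%g, 1%g)
    [set zk : G * G | [/\ Zc zk.1, Kp zk.2 & h = (zk.1 * zk.2)%g]]).2 in
  psi0 (gval k 0 1 + gval k 1 2 + t * w^-1 * gval k 3 0).

Definition gchi : G := toGSp4 (mx4
  [:: [:: 0;         0;     1; 0];
      [:: 0;         0;     0; - 1];
      [:: - (w / t); 0;     0; 0];
      [:: 0;         w / t; 0; 0]]).

Lemma gchiE : w != 0 -> t != 0 -> gval gchi = mx4
  [:: [:: 0;         0;     1; 0];
      [:: 0;         0;     0; - 1];
      [:: - (w / t); 0;     0; 0];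
      [:: 0;         w / t; 0; 0]].
Proof.
move=> w0 t0; apply: (@toGSp4E _ (- (w / t))).
  by rewrite oppr_eq0 mulf_neq0// invr_neq0.
mx4_ring.
Qed.

Definition Hgrp' : set G := Hgrp `|` [set (gchi * h)%g | h in Hgrp].

(* The character chi^+ (s = false) or chi^- (s = true) of H'; junk elsewhere *)
Definition chipm (g : G) : R[i] :=
  if `[< Hgrp g >] then chi g else (-1) ^+ s * chi (gchi^-1 * g)%g.

Definition fmin (g : G) : R[i] := if `[< Hgrp' g >] then chipm g else 0.

Definition rtrans (g : G) (f : G -> R[i]) : G -> R[i] := fun x => f (x * g)%g.

(* c-Ind(chi^+-): smooth functions with compact support modulo H',
   on which G acts by [rtrans]; it contains [fmin] and its translates. *)
Definition sigma_chi : set (G -> R[i]) := [set f |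
  [/\ forall h g, Hgrp' h -> f (h * g)%g = chipm h * f g,
      exists2 V : set G, nbhs (1%g : G) V & forall g k, V k -> f (g * k)%g = f g
    & exists2 C : set G, compact C &
        forall g, f g != 0 -> [set (h * x)%g | h in Hgrp' & x in C] g]].

Variable nu : {measure set (borel (ZG F)) -> \bar R}.

(* For [f1], [f2] in [sigma_chi], [f1 * f2^*] is left Z-invariant, so that
   its value at the representative [repr y] only depends on [y]. *)
Definition inner (f1 f2 : G -> R[i]) : R[i] :=
  ((fine (nu [set \pi_(ZG F) h | h in Hgrp']))^-1)%:C%C *
  cintegral nu (fun y => f1 (repr (y : ZG F)) * (f2 (repr (y : ZG F)))^*).

Definition dmat (a b : F) : G := toGSp4 (mx4
  [:: [:: a ^+ 2 * b; 0;     0; 0];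
      [:: 0;          a * b; 0; 0];
      [:: 0;          0;     a; 0];
      [:: 0;          0;     0; 1]]).

Lemma dmatE (a b : F) : a != 0 -> b != 0 -> gval (dmat a b) = mx4
  [:: [:: a ^+ 2 * b; 0;     0; 0];
      [:: 0;          a * b; 0; 0];
      [:: 0;          0;     a; 0];
      [:: 0;          0;     0; 1]].
Proof.
move=> a0 b0; apply: (@toGSp4E _ (a ^+ 2 * b)).
  by rewrite mulf_neq0// expf_neq0.
mx4_ring.
Qed.

Definition umat (a b c e : F) : G := toGSp4 (
  mx4 [:: [:: 1; a; 0; 0];
          [:: 0; 1; 0; 0];
          [:: 0; 0; 1; - a];
          [:: 0; 0; 0; 1]] *m
  mx4 [:: [:: 1; 0; b; c];
          [:: 0; 1; e; b];
          [:: 0; 0; 1; 0];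
          [:: 0; 0; 0; 1]]).

Lemma umatE (a b c e : F) : gval (umat a b c e) =
  mx4 [:: [:: 1; a; 0; 0];
          [:: 0; 1; 0; 0];
          [:: 0; 0; 1; - a];
          [:: 0; 0; 0; 1]] *m
  mx4 [:: [:: 1; 0; b; c];
          [:: 0; 1; e; b];
          [:: 0; 0; 1; 0];
          [:: 0; 0; 0; 1]].
Proof.
apply: (@toGSp4E _ 1); first exact: oner_neq0.
set A := mx4 _; set B := mx4 _.
have -> : (A *m B)^T *m J4 F *m (A *m B) = B^T *m (A^T *m J4 F *m A) *m B.
  by rewrite trmx_mul !mulmxA.
have -> : A^T *m J4 F *m A = J4 F by mx4_ring.
rewrite scale1r; mx4_ring.
Qed.

Variables (mu : {sigma_finite_measure set (borelF F) -> \bar R}) (c1 c2 : F).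

(* J_0(v1, v2), as an integral over (a, b, c, e) in F^4 *)
Definition J0 (v1 v2 : G -> R[i]) : R[i] :=
  cintegral (mu \x mu \x mu \x mu)%E
    (fun x : borelF F * borelF F * borelF F * borelF F =>
       let: (a, b, c, e) := x in
       inner (rtrans (umat a b c e) v1) v2 * (psi (c1 * a + c2 * e))^-1).

(* J_0(v) *)
Definition J0norm (v : G -> R[i]) : R[i] := J0 v v / inner v v.

End Representation.

Definition J0_support (F : naLocalFieldType) (w c1 c2 a b g d : F) : Prop :=
  [/\ lunit1 (a / g), lunit1 (b / d),
      [set w^-1 * c1^-1 * y | y in lunit1] g
    & [set w^-1 * c2^-1 * y | y in lunit1] d].

(* Main.v *)
(* Since [fmin] is supported on H' and satisfies f(hx) = chi(h) f(x) there, the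
   matrix coefficient of [fmin] is [fmin] itself: after translating by
   d_{gamma,delta}, the integrand is constant on one coset space Z\H', whose
   measure is positive and finite because K' is open and compact. Hence
   J_0(d_{alpha,beta} f, d_{gamma,delta} f) is the integral over U of
   f(d_{gamma,delta}^-1 u d_{alpha,beta}) psi_{c1,c2}^-1(u). An upper triangular
   matrix with last entry 1 lies in H' only if it lies in K', so this function
   vanishes unless alpha/gamma and beta/delta are in 1 + p, and then it is the
   indicator function of a box of fractional ideals times the additive character
   (a, e) |-> psi((w^-1/gamma - c1) a + (w^-1/delta - c2) e). If that character is
   nontrivial on the box, translation invariance forces the integral to be 0;
   otherwise gamma and delta have valuation -1 and the integral is the volume of
   the box p^-1 x p^-2 x p^-3 x p^-1, which is q^7. *)

Require Import Defs.
From HB Require Import structures.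
From mathcomp Require Import all_boot all_order all_algebra generic_quotient.
From mathcomp Require Import complex ring zify.
From mathcomp Require Import all_classical all_reals all_analysis.
From mathcomp Require Import measurable_realfun.

Set Implicit Arguments.
Unset Strict Implicit.
Unset Printing Implicit Defensive.

Import Order.TTheory GRing.Theory Num.Theory.

Local Open Scope classical_set_scope.
Local Open Scope ring_scope.

(** * Valuations and fractional ideals *)

Section Valuation.
Variable F : naLocalFieldType.
Implicit Types (x y z : F) (m n : int).

Lemma lval1 : lval (1 : F) = 0.
Proof.
have := @lvalM F 1 1 (oner_neq0 _) (oner_neq0 _); rewrite mulr1 => h.
by apply: (@addrI _ (lval (1 : F))); rewrite addr0.
Qed.

Lemma lvalN x : lval (- x) = lval x.
Proof.
have [->|x0] := eqVneq x 0; first by rewrite oppr0.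
have N1 : - 1 != 0 :> F by rewrite oppr_eq0 oner_neq0.
have := @lvalM F (- 1) (- 1) N1 N1; rewrite mulrNN mulr1 lval1 => h.
rewrite -mulN1r lvalM//; lia.
Qed.

Lemma lvalV x : x != 0 -> lval x^-1 = - lval x.
Proof.
move=> x0; have x'0 : x^-1 != 0 by rewrite invr_eq0.
by have := lvalM x x^-1 x0 x'0; rewrite divff// lval1; lia.
Qed.

Lemma lvalX x (k : nat) : x != 0 -> lval (x ^+ k) = lval x * k%:Z.
Proof.
move=> x0; elim: k => [|k IH]; first by rewrite expr0 lval1; lia.
rewrite exprS lvalM ?expf_neq0// IH; lia.
Qed.

Lemma lvalXz x n : x != 0 -> lval (x ^ n) = lval x * n.
Proof.
move=> x0; case: n => k; rewrite /exprz ?lvalX//.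
by rewrite lvalV ?expf_neq0// lvalX// NegzE; lia.
Qed.

Lemma pideal0 n : pideal n (0 : F).
Proof. by left. Qed.

Lemma pideal_lval x : pideal (lval x) x.
Proof. by right. Qed.

Lemma pidealE n x : x != 0 -> pideal n x <-> n <= lval x.
Proof. by move=> x0; split=> [[xE|//]|]; [rewrite xE eqxx in x0|right]. Qed.

Lemma le_pideal m n x : n <= m -> pideal m x -> pideal n x.
Proof. by move=> nm [->|mx]; [left|right; lia]. Qed.

Lemma pidealN n x : pideal n (- x) <-> pideal n x.
Proof.
suff h y : pideal n y -> pideal n (- y).
  by split=> [/h|/h//]; rewrite opprK.
by move=> [->|ny]; [left; rewrite oppr0|right; rewrite lvalN].
Qed.

Lemma pidealD n x y : pideal n x -> pideal n y -> pideal n (x + y).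
Proof.
have [->|x0] := eqVneq x 0; first by rewrite add0r.
have [->|y0] := eqVneq y 0; first by rewrite addr0.
have [->|xy0] := eqVneq (x + y) 0; first by left.
move=> /(pidealE _ x0) nx /(pidealE _ y0) ny; right.
by apply: le_trans (lvalD x y x0 y0 xy0); rewrite le_min nx ny.
Qed.

Lemma pidealB n x y : pideal n x -> pideal n y -> pideal n (x - y).
Proof. by move=> nx ny; apply: pidealD => //; apply/pidealN. Qed.

Lemma pidealM m n x y : pideal m x -> pideal n y -> pideal (m + n) (x * y).
Proof.
have [->|x0] := eqVneq x 0; first by rewrite mul0r; left.
have [->|y0] := eqVneq y 0; first by rewrite mulr0; left.
move=> /(pidealE _ x0) nx /(pidealE _ y0) ny; right.
by rewrite lvalM//; lia.
Qed.

Lemma pidealMr n x y : y != 0 -> pideal n (x * y) <-> pideal (n - lval y) x.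
Proof.
move=> y0; split=> [h|/pidealM/(_ (pideal_lval y))]; last by rewrite subrK.
rewrite -(mulfK y0 x) -lvalV//; apply: pidealM => //; exact: pideal_lval.
Qed.

Lemma pideal_sum n (I : Type) (r : seq I) (P : pred I) (f : I -> F) :
  (forall i, P i -> pideal n (f i)) -> pideal n (\sum_(i <- r | P i) f i).
Proof.
by move=> h; elim/big_ind : _ => //; [exact: pideal0|exact: pidealD].
Qed.

Lemma pideal_eq0 x : (forall n, pideal n x) -> x = 0.
Proof.
have [//|x0] := eqVneq x 0.
by move=> /(_ (lval x + 1))/(pidealE _ x0); lia.
Qed.

Lemma lunit1P x : lunit1 x <-> pideal 1 (x - 1).
Proof.
split=> [[y h <-]|h]; first by rewrite addrC addKr.
by exists (x - 1) => //; rewrite addrC subrK.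
Qed.

Lemma lunit1_neq0 x : lunit1 x -> x != 0.
Proof.
move=> /lunit1P h; apply/eqP => x0; move: h; rewrite x0 sub0r => /pidealN.
by move/(pidealE _ (oner_neq0 _)); rewrite lval1.
Qed.

Lemma pideal1 : pideal 0 (1 : F).
Proof. by right; rewrite lval1. Qed.

Lemma lunit1_int x : lunit1 x -> pideal 0 x.
Proof.
move=> /lunit1P/(@le_pideal 1 0 _ isT) h.
by rewrite -(subrK 1 x); apply: pidealD h pideal1.
Qed.

Lemma lval_lunit1 x : lunit1 x -> lval x = 0.
Proof.
move=> h; have x0 := lunit1_neq0 h; have /(pidealE _ x0) := lunit1_int h.
have : ~ pideal 1 x; last by rewrite pidealE//; lia.
move=> x1; move/lunit1P : h => /(pidealB x1); rewrite subKr.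
by move/(pidealE _ (oner_neq0 _)); rewrite lval1.
Qed.

Lemma lunit1_one : lunit1 (1 : F).
Proof. by apply/lunit1P; rewrite subrr; left. Qed.

Lemma lunit1M x y : lunit1 x -> lunit1 y -> lunit1 (x * y).
Proof.
move=> hx /lunit1P hy; apply/lunit1P.
have -> : x * y - 1 = x * (y - 1) + (x - 1) by ring.
apply: pidealD; last exact/lunit1P.
by rewrite -[1]add0r; apply: pidealM => //; apply: lunit1_int.
Qed.

Lemma lunit1V x : lunit1 x -> lunit1 x^-1.
Proof.
move=> h; have x0 := lunit1_neq0 h; apply/lunit1P.
suff : pideal 1 ((x^-1 - 1) * x) by rewrite pidealMr// lval_lunit1// subr0.
by rewrite mulrBl mulVf// mul1r -opprB; apply/pidealN/lunit1P.
Qed.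

Lemma lunit1_div x y : lunit1 x -> lunit1 y -> lunit1 (x / y).
Proof. by move=> hx hy; apply: lunit1M => //; apply: lunit1V. Qed.

Lemma lunit1D x y : lunit1 x -> pideal 1 y -> lunit1 (x + y).
Proof.
by move=> /lunit1P hx hy; apply/lunit1P; rewrite addrAC; apply: pidealD.
Qed.

End Valuation.
#[global] Hint Resolve pideal0 : core.

(** * Residue classes inside a fractional ideal *)

Section Cosets.
Variables (F : naLocalFieldType) (w : F).
Hypothesis hw : is_uniformizer w.

Lemma wn0 n : w ^ n != 0. Proof. by apply: expfz_neq0; case: hw. Qed.

Lemma lval_wn n : lval (w ^ n) = n.
Proof. by case: hw => w0 w1; rewrite lvalXz// w1 mul1r. Qed.

Definition scale_set (c : F) (C : set F) : set F := [set c * x | x in C].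

(** Multiplication by [w ^ n] carries the residue classes of the integers to the classes of p^n
    modulo p^(n+1). This finite partition serves both the compactness of p^n and the computation of
    its volume. *)
Lemma pideal_cosets n :
  pideal n = \bigcup_(C in vcosets (@lval F)) scale_set (w ^ n) C.
Proof.
apply/seteqP; split=> [x nx|x [_ [y y0 <-] [_ [z z1 <-] <-]]].
  exists [set x / w ^ n + z | z in vball lval 1].
    exists (x / w ^ n) => //.
    rewrite -[vball _ _ _]/(pideal 0 _) pidealMr ?invr_neq0 ?wn0//.
    by rewrite lvalV ?wn0// lval_wn opprK add0r.
  exists (x / w ^ n); last by rewrite mulrC divfK// wn0.
  by exists 0; [left|rewrite addr0].
rewrite mulrC pidealMr ?wn0// lval_wn subrr; apply: pidealD => //.
exact: (@le_pideal _ 1).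
Qed.

Lemma scale_coset n x :
  scale_set (w ^ n) [set x + y | y in vball lval 1] =
  [set w ^ n * x + y | y in pideal (n + 1)].
Proof.
apply/seteqP; split=> [_ [_ [y y1 <-] <-]|_ [y y1 <-]].
  exists (w ^ n * y); last by rewrite mulrDr.
  by apply: pidealM => //; rewrite -[X in pideal X]lval_wn; exact: pideal_lval.
exists (x + y / w ^ n); last by rewrite mulrDr [w ^ n * (y / _)]mulrC divfK// wn0.
exists (y / w ^ n) => //.
rewrite -[vball _ _ _]/(pideal 1 _) pidealMr ?invr_neq0 ?wn0// lvalV ?wn0//.
by rewrite lval_wn opprK addrC.
Qed.

Lemma trivIset_scale_cosets n :
  trivIset (vcosets (@lval F)) (scale_set (w ^ n)).
Proof.
move=> _ _ [x _ <-] [y _ <-] [u []].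
rewrite !scale_coset => -[a a1 <-] [b b1 e].
have xy : pideal 1 (x - y).
  have : pideal (n + 1) ((x - y) * w ^ n).
    have -> : (x - y) * w ^ n = b - a 
      by rewrite mulrC mulrBr -[b](addKr (w ^ n * y)) e; ring.
    exact: pidealB.
  by rewrite pidealMr ?wn0// lval_wn addrC addKr.
apply/seteqP; split=> _ [z z1 <-].
  by exists (x - y + z); [apply: pidealD|ring].
exists (y - x + z); last ring.
by apply: pidealD => //; rewrite -opprB; apply/pidealN.
Qed.

End Cosets.

(** * Compactness and openness of fractional ideals *)

Section Topology.
Variable F : naLocalFieldType.

Lemma nbhs_pideal (x : F) n : nbhs x [set y | pideal n (y - x)].
Proof.
apply/lval_nbhs; exists n => _ [y ny <-] /=; by rewrite addrC addKr.
Qed.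

Lemma nbhs_pidealP (x : F) (A : set F) :
  nbhs x A <-> exists n, forall y, pideal n (y - x) -> A y.
Proof.
rewrite lval_nbhs; split=> -[n nA]; exists n.
  by move=> y ny; apply: nA; exists (y - x) => //; rewrite addrC subrK.
by move=> _ [y ny <-]; apply: nA; rewrite addrC addKr.
Qed.

(** An ultrafilter on p^n singles out a class modulo p^(n+k) for each k, as each refinement is
    finite. Centers of these classes form a Cauchy sequence, which converges by completeness. *)
Lemma pideal_compact n : compact (@pideal F n).
Proof.
have [w w0 w1] := @lval_surj F; have hw : is_uniformizer w by [].
rewrite compact_ultra => U UU Un.
have filterI2 A B (UA : U A) (UB : U B) : U (A `&` B) by exact: filterI.
have step (k : nat) : exists x : F, U [set y | pideal (n + k%:Z) (y - x)].
  elim: k => [|k [x xU]].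
    by exists 0; apply: filterS Un => y; rewrite addr0 /= subr0.
  apply: contrapT => /forallNP noU.
  have fin := @lval_finite F.
  (* If no class of the next level belonged to [U], the finite intersection of their complements
     would, and it misses x + p^(n+k). *)
  pose A (C : set F) := ~` [set x + y | y in scale_set (w ^ (n + k%:Z)) C].
  have UA C : vcosets (@lval F) C -> U (A C).
    move=> [c c0 <-]; rewrite /A scale_coset//.
    set B := image _ _; have [h|//] := in_ultra_setVsetC B UU.
    exfalso; apply: (noU (x + w ^ (n + k%:Z) * c)); apply: filterS h.
    move=> _ [_ [z z1 <-] <-] /=.
    rewrite (_ : _ - _ = z); last ring.
    by apply: le_pideal z1; lia.
  have : U (\bigcap_(C in vcosets (@lval F)) A C).
    rewrite -(fset_setK fin); apply: filter_bigI => C.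
    by rewrite in_fset_set// inE; exact: UA.
  move=> /(filterI xU) /filter_ex[y [/= xy Ay]].
  have : pideal (n + k%:Z) (y - x) by [].
  rewrite (pideal_cosets hw) => -[C hC yC]; apply: (Ay C hC).
  by exists (y - x) => //; rewrite addrC subrK.
have [f fU] := choice step.
have fB (i j : nat) : (i <= j)%N -> pideal (n + i%:Z) (f j - f i).
  move=> ij; have /filter_ex[y /= [yi yj]] := filterI2 _ _ (fU i) (fU j).
  have -> : f j - f i = (y - f i) - (y - f j) by ring.
  by apply: pidealB => //; apply: le_pideal yj; lia.
have [l fl] : exists l : F, f @ \oo --> l.
  (* The index is the distance from [m] to [n], which added to [n] is at least [m]. *)
  apply: lval_complete => m; exists `|m - n|%N => i j hi hj.
  rewrite -[vball _ _ _]/(pideal m _).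
  have -> : f i - f j = (f i - f `|m - n|%N) - (f j - f `|m - n|%N) by ring.
  by apply: pidealB; (apply: (@le_pideal _ (n + `|m - n|%N%:Z)); [lia|exact: fB]).
have lf (i : nat) : pideal (n + i%:Z) (l - f i).
  have [N _ hN] := fl _ (nbhs_pideal l (n + i%:Z)).
  have := hN (maxn N i) (leq_maxl _ _) => /=.
  have -> : l - f i = (f (maxn N i) - f i) - (f (maxn N i) - l) by ring.
  by move=> h; apply: pidealB => //; apply: fB; exact: leq_maxr.
exists l; split.
  have /filter_ex[y /= [y1 y2]] := filterI2 _ _ Un (fU 0%N).
  have -> : l = (l - f 0%N) - (y - f 0%N) + y by ring.
  apply: pidealD y1; apply: pidealB; last by rewrite addr0 in y2.
  by have := lf 0%N; rewrite addr0.
move=> A /nbhs_pidealP[m mA].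
apply: filterS (fU `|m - n|%N) => y /= hy; apply: mA.
have -> : y - l = (y - f `|m - n|%N) - (l - f `|m - n|%N) by ring.
by apply: (@le_pideal _ (n + `|m - n|%N%:Z)); [lia|exact: pidealB].
Qed.

Lemma pideal_open n (x : F) : open [set y | pideal n (y - x)].
Proof.
rewrite openE => y /= xy; rewrite /interior; apply/nbhs_pidealP; exists n => z zy /=.
have -> : z - x = (z - y) + (y - x) by ring.
exact: pidealD.
Qed.

End Topology.

(** * Additive characters *)

Section Character.
Variables (F : naLocalFieldType) (R : realType) (psi : F -> R[i]).
Hypothesis hpsi : is_character psi.

(** Two distinct natural numbers share one of the finitely many residue classes, and their
    difference lies in p. *)
Lemma exists_nat_lmax : exists2 N : nat, (0 < N)%N & pideal 1 (N%:R : F).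
Proof.
have [f fE] : exists f : nat -> set F,
  forall k, f k = [set k%:R + y | y in vball lval 1] by eexists.
have f_cosets k : vcosets (@lval F) (f k).
  exists k%:R; last by rewrite fE.
  elim: k => [|k IH]; first by left.
  rewrite -natr1; apply: pidealD => //; exact: pideal1.
have [i [j [ij fij]]] : exists i j, (i < j)%N /\ f i = f j.
  apply: contrapT => h; apply: infinite_nat.
  rewrite (_ : setT = f @^-1` vcosets (@lval F)).
    apply: finite_preimage (@lval_finite F) => i j _ _ fij.
    case: (ltngtP i j) => // ij; exfalso; apply: h.
      by exists i; exists j; split; [exact: ij|exact: fij].
    by exists j; exists i; split; [exact: ij|exact: esym].
  by apply/seteqP; split=> k _ //=; exact: f_cosets.
exists (j - i)%N; first by rewrite subn_gt0.
have : f i j%:R by rewrite fij fE; exists 0; [left|rewrite addr0].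
rewrite fE => -[y y1 e].
by rewrite (natrB _ (ltnW ij)) -e addrC addKr.
Qed.

Lemma psi0E : psi 0 = 1.
Proof. by case: hpsi => _ _ h _; apply: h; exact: pideal0. Qed.

Lemma psiD x y : psi (x + y) = psi x * psi y.
Proof. by case: hpsi. Qed.

Lemma psi_lint x : pideal 0 x -> psi x = 1.
Proof. by case: hpsi => _ _ h _; exact: h. Qed.

Lemma psi_neq0 x : psi x != 0.
Proof. by case: hpsi. Qed.

Lemma psiN x : psi (- x) = (psi x)^-1.
Proof.
by apply: (mulfI (psi_neq0 x)); rewrite -psiD subrr psi0E divff// psi_neq0.
Qed.

Lemma psi_mulrn x k : psi (x *+ k) = psi x ^+ k.
Proof.
by elim: k => [|k IH]; rewrite ?mulr0n ?psi0E ?expr0// mulrS psiD IH exprS.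
Qed.

(* [psi] has finite order on each [x], as the natural number [N ^ k] kills [x]
   modulo [o] for large [k]. *)
Lemma norm_psi x : `|psi x| = 1.
Proof.
have [N N0 NF] := exists_nat_lmax.
have [k xk] : exists k, pideal 0 (x * (N ^ k)%:R).
  exists `|lval x|%N; have Nk (k : nat) : pideal k%:Z ((N ^ k)%:R : F).
    elim: k => [|k IH]; first by rewrite expn0; exact: pideal1.
    rewrite expnS natrM; apply: (@le_pideal _ (1 + k%:Z)); first lia.
    exact: pidealM.
  apply: (@le_pideal _ (lval x + `|lval x|%N%:Z)); first lia.
  by apply: pidealM (Nk _); exact: pideal_lval.
have : `|psi x| ^+ (N ^ k) = 1.
  by rewrite -normrX -psi_mulrn -mulr_natr psi_lint ?normr1.
by move/eqP; rewrite pexpr_eq1 ?expn_gt0 ?N0// => /eqP.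
Qed.

(** Dividing by [l] an element of p^(-1) on which [psi] is nontrivial gives a witness; the strict
    inequality places it in p^n. *)
Lemma psi_pideal_neq1 (n : int) (l : F) : l != 0 -> n + lval l < 0 ->
  exists2 y, pideal n y & psi (l * y) != 1.
Proof.
move=> l0 ln; have [_ _ _ [x x1 px]] := hpsi.
exists (x / l); last by rewrite mulrC divfK.
rewrite pidealMr ?invr_neq0// lvalV// opprK.
by apply: le_pideal x1; lia.
Qed.

End Character.

(** * The pro-p Iwahori subgroup *)

Lemma ord4P (P : 'I_4 -> Prop) : P 0 -> P 1 -> P 2 -> P 3 -> forall i, P i.
Proof.
move=> P0 P1 P2 P3; case=> [[|[|[|[|//]]]] hi].
- by rewrite (_ : Ordinal hi = 0)//; apply: val_inj.
- by rewrite (_ : Ordinal hi = 1)//; apply: val_inj.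
- by rewrite (_ : Ordinal hi = 2)//; apply: val_inj.
- by rewrite (_ : Ordinal hi = 3)//; apply: val_inj.
Qed.

Lemma sum4 (V : nmodType) (f : 'I_4 -> V) :
  \sum_i f i = f 0 + f 1 + f 2 + f 3.
Proof.
rewrite !big_ord_recl big_ord0 addr0 !addrA.
by do ![congr (_ + _)]; congr f; apply: val_inj.
Qed.

(** * Similitude factors and inverses of explicit 4 by 4 matrices *)

Section Matrix4.
Variable F : fieldType.

Lemma mx4_eta (A : 'M[F]_4) : A = mx4
  [:: [:: A 0 0; A 0 1; A 0 2; A 0 3]; [:: A 1 0; A 1 1; A 1 2; A 1 3];
      [:: A 2 0; A 2 1; A 2 2; A 2 3]; [:: A 3 0; A 3 1; A 3 2; A 3 3]].
Proof. by apply/matrixP; do 2!apply: ord4P; rewrite mxE. Qed.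

(** The similitude factor, read at an entry where [J4] equals 1. It is defined for every matrix so
    that it applies to a limit of group elements before that limit is known to be in the group. *)
Definition gmult (g : 'M[F]_4) : F := (g^T *m J4 F *m g) 0 3.

Lemma gmultE g :
  gmult g = g 0 0 * g 3 3 + g 1 0 * g 2 3 - g 2 0 * g 1 3 - g 3 0 * g 0 3.
Proof. by rewrite /gmult {1 2}[g]mx4_eta /J4 mx4T !mx4M !mxE /=; ring. Qed.

Lemma gsp_gmult (g : GSp4 F) : (gval g)^T *m J4 F *m g = gmult g *: J4 F.
Proof.
have [m _ gE] := asboolW (andP (valP g)).2.
by rewrite /gmult gE; congr (_ *: _); rewrite /J4 !mxE /= mulr1.
Qed.

Lemma J4K : J4 F *m - J4 F = 1%:M.
Proof.
rewrite [RHS]mx4_eta -scaleN1r /J4 mx4Z mx4M !mxE /=.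
by do ?[congr mx4 | congr cons]; ring.
Qed.

Lemma gmult_neq0 (g : GSp4 F) : gmult g != 0.
Proof.
apply/eqP => g0; have := gsp_gmult g; rewrite g0 scale0r => e.
have : (gval g)^T *m J4 F *m gval g \in unitmx.
  rewrite !unitmx_mul unitmx_tr !gsp_unit; case/mulmx1_unit : J4K => -> _.
  by [].
by rewrite e => /mulmxV/matrixP/(_ 0 0)/eqP; rewrite mul0mx !mxE /= eq_sym oner_eq0.
Qed.

(** From A^T J A = m J and J^-1 = -J follows A^-1 = -m^-1 J A^T J. Up to sign and scaling this
    permutes the entries of A, which makes the integrality of inverses visible. *)
Lemma gsp_invE (g : GSp4 F) (A := gval g) : gval g^-1%g = (gmult g)^-1 *: mx4
  [:: [:: A 3 3; A 2 3; - A 1 3; - A 0 3]; [:: A 3 2; A 2 2; - A 1 2; - A 0 2];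
      [:: - A 3 1; - A 2 1; A 1 1; A 0 1]; [:: - A 3 0; - A 2 0; A 1 0; A 0 0]].
Proof.
rewrite (_ : mx4 _ = - J4 F *m A^T *m J4 F); last first.
  rewrite [in RHS](mx4_eta A) -scaleN1r /J4 mx4Z mx4T !mx4M.
  by do ?[congr mx4 | congr cons]; ring.
have JK := mulmx1C J4K.
have e : (gmult g)^-1 *: (- J4 F *m A^T *m J4 F) *m A = 1%:M.
  rewrite -scalemxAl -!mulmxA [A^T *m _]mulmxA gsp_gmult.
  by rewrite -scalemxAr JK scalerA mulVf ?scale1r// gmult_neq0.
have AV : A *m gval g^-1%g = 1%:M := mulmxV (gsp_unit g).
by rewrite -[LHS]mul1mx -e -(mulmxA _ A) AV mulmx1.
Qed.

End Matrix4.

Section Iwahori.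
Variables (F : naLocalFieldType) (w : F).
Hypothesis hw : is_uniformizer w.
Local Notation G := (GSp4 F).
Implicit Types (g h k z : G).

(** Commuting with a diagonal matrix whose entries have distinct valuations forces [z] to be
    diagonal; commuting with a unipotent matrix having nonzero superdiagonal then equates
    consecutive diagonal entries. *)
Lemma ZcP z : Zc z <-> exists2 c, c != 0 & gval z = c%:M.
Proof.
split=> [zC|[c c0 zE] g]; last first.
  by apply: val_inj; rewrite /= zE mul_scalar_mx mul_mx_scalar.
have [w0 w1] := hw.
(* This is diag(w^3, w^2, w, 1), with valuations 3, 2, 1, 0. *)
have dE : gval (dmat w w) = diag_mx (\row_(i < 4) w ^+ (3 - i)).
  by apply/matrixP; do 2!apply: ord4P; rewrite dmatE// !mxE //=; ring.
have offdiag i j : i != j -> gval z i j = 0.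
  move=> ij; have /(congr1 (fun g => gval g i j)) /= := zC (dmat w w).
  rewrite dE mul_mx_diag mul_diag_mx !mxE => /eqP; rewrite mulrC -subr_eq0.
  rewrite -mulrBl mulf_eq0 => /orP[|/eqP//]; rewrite subr_eq0 => /eqP.
  move/(congr1 lval); rewrite !lvalX// w1 => e; case/eqP: ij.
  apply: val_inj => /=; have := ltn_ord i; have := ltn_ord j; lia.
have uE : gval (umat 1 0 0 1 : G) = mx4 [:: [:: 1; 1; 1; 0];
   [:: 0; 1; 1; 0]; [:: 0; 0; 1; - 1]; [:: 0; 0; 0; 1]].
  rewrite umatE mx4M; by do ?[congr mx4 | congr cons]; ring.
have zE i j : (gval z *m gval (umat 1 0 0 1)) i j =
    (gval (umat 1 0 0 1) *m gval z) i j by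
  rewrite -[gval z *m _]/(gval (z * umat 1%R 0%R 0%R 1%R)%g) zC.
have off := (offdiag 0 1 isT, offdiag 0 2 isT, offdiag 0 3 isT,
  offdiag 1 0 isT, offdiag 1 2 isT, offdiag 1 3 isT,
  offdiag 2 0 isT, offdiag 2 1 isT, offdiag 2 3 isT,
  offdiag 3 0 isT, offdiag 3 1 isT, offdiag 3 2 isT).
have z01 : gval z 0 0 = gval z 1 1.
  have := zE 0 1; rewrite uE !mxE !sum4 !mxE /= !off.
  by rewrite !(mulr0, mul0r, add0r, addr0, mulr1, mul1r).
have z12 : gval z 1 1 = gval z 2 2.
  have := zE 1 2; rewrite uE !mxE !sum4 !mxE /= !off.
  by rewrite !(mulr0, mul0r, add0r, addr0, mulr1, mul1r).
have z23 : gval z 2 2 = gval z 3 3.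
  have := zE 2 3; rewrite uE !mxE !sum4 !mxE /= !off.
  by rewrite !(mulr0, mul0r, add0r, addr0, mulr1, mul1r, mulrN1, mulN1r) => /oppr_inj.
have zS : gval z = (gval z 0 0)%:M.
  apply/matrixP; do 2!apply: ord4P; rewrite ?mxE //= ?mulr1n ?mulr0n ?off //.
  - by rewrite z01 z12.
  - by rewrite z01 z12 z23.
exists (gval z 0 0) => //; apply: contraTneq (gsp_unit z) => z0.
rewrite zS z0; apply/negP => /mulmxV/matrixP/(_ 0 0)/eqP.
by rewrite raddf0 mul0mx !mxE /= eq_sym oner_eq0.
Qed.

(** Once the identity is subtracted, a single exponent, 1 on and below the diagonal and 0 above it,
    replaces the three cases of [Kp]. *)
Lemma KpP k : Kp k <-> forall i j : 'I_4,
  pideal ((j <= i)%N : nat)%:Z (gval k i j - (i == j)%:R).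
Proof.
split=> + i j => /(_ i j); case: (ltngtP i j) => ij.
- have /negPf -> : i != j by apply/eqP => e; rewrite e ltnn in ij.
  by rewrite subr0.
- have /negPf -> : i != j by apply/eqP => e; rewrite e ltnn in ij.
  by rewrite subr0.
- by move/val_inj : ij => ->; rewrite eqxx => /lunit1P.
- have /negPf -> : i != j by apply/eqP => e; rewrite e ltnn in ij.
  by rewrite subr0.
- have /negPf -> : i != j by apply/eqP => e; rewrite e ltnn in ij.
  by rewrite subr0.
- by move/val_inj : ij => ->; rewrite eqxx => ?; apply/lunit1P.
Qed.

Lemma Kp1 : Kp (1%g : G).
Proof. by apply/KpP => i j; rewrite /= mxE subrr. Qed.

Lemma KpM k k' : Kp k -> Kp k' -> Kp (k * k')%g.
Proof.
move=> /KpP hk /KpP hk'; apply/KpP => i j /=.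
pose A := gval k - 1%:M; pose B := gval k' - 1%:M.
have kE : gval k = A + 1%:M by rewrite /A subrK.
have k'E : gval k' = B + 1%:M by rewrite /B subrK.
have hA (i' j' : 'I_4) : pideal ((j' <= i')%N : nat)%:Z (A i' j').
  by rewrite /A !mxE; exact: hk.
have hB (i' j' : 'I_4) : pideal ((j' <= i')%N : nat)%:Z (B i' j').
  by rewrite /B !mxE; exact: hk'.
have -> : (gval k *m gval k') i j - (i == j)%:R =
    \sum_l A i l * B l j + A i j + B i j.
  rewrite kE k'E mulmxDl mulmxDr mulmx1 mul1mx !mxE; ring.
do 2?[apply: pidealD => //]; apply: pideal_sum => l _.
(* If [j <= i], every [l] satisfies [l <= i] or [j <= l], so at least one factor lies in p. *)
apply: le_pideal (pidealM (hA i l) (hB l j)); lia.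
Qed.

Lemma Kp_diag k i : Kp k -> lunit1 (gval k i i).
Proof. by move=> /(_ i i); rewrite ltnn eqxx. Qed.

Lemma Kp_upper k (i j : 'I_4) : Kp k -> (i < j)%N -> pideal 0 (gval k i j).
Proof. by move=> /(_ i j) + ij; rewrite ij. Qed.

Lemma Kp_lower k (i j : 'I_4) : Kp k -> (j < i)%N -> pideal 1 (gval k i j).
Proof.
move=> /(_ i j) + ij; rewrite ltnNge (ltnW ij) /=.
by have /negPf -> : i != j by apply/eqP => e; rewrite e ltnn in ij.
Qed.

(** The product of the two outer diagonal entries is in 1 + p, and every other term has a factor
    below the diagonal. The form for matrices also covers limits of elements of K'. *)
Lemma lunit1_gmult (A : 'M[F]_4) :
    (forall i j : 'I_4, if (i < j)%N then lint (A i j)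
       else if i == j then lunit1 (A i j) else lmax (A i j)) ->
  lunit1 (gmult A).
Proof.
move=> hA; rewrite gmultE.
have p1 x y : pideal 1 x -> pideal 0 y -> pideal 1 (x * y).
  by move=> h h'; rewrite -[1%R]addr0; apply: pidealM.
rewrite -!addrA; apply: lunit1D.
  by apply: lunit1M; [exact: (hA 0 0)|exact: (hA 3 3)].
apply: pidealD; first by apply: p1; [exact: (hA 1 0)|exact: (hA 2 3)].
apply: pidealB; [apply/pidealN|]; apply: p1;
  by [exact: (hA 2 0)|exact: (hA 1 3)|exact: (hA 3 0)|exact: (hA 0 3)].
Qed.

(** By [gsp_invE], inversion reflects the entries in the antidiagonal, up to sign and a factor in 1
    + p. This reflection preserves the diagonal and both triangles. *)
Lemma KpV k : Kp k -> Kp (k^-1)%g.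
Proof.
move=> hk; have m1 : lunit1 (gmult k)^-1 by apply/lunit1V/lunit1_gmult.
have m0 := lunit1_int m1.
suff : forall i j : 'I_4, if (i < j)%N then lint (gval (k^-1)%g i j)
    else if i == j then lunit1 (gval (k^-1)%g i j) else lmax (gval (k^-1)%g i j).
  by [].
have mU x : lunit1 x -> lunit1 ((gmult k)^-1 * x) by move=> h; apply: lunit1M.
have mI x : pideal 0 x -> lint ((gmult k)^-1 * x).
  by move=> h; rewrite /lint -[0]add0r; apply: pidealM.
have mM x : pideal 1 x -> lmax ((gmult k)^-1 * x).
  by move=> h; rewrite /lmax -[1%R]add0r; apply: pidealM.
rewrite gsp_invE; do 2!apply: ord4P; rewrite !mxE /=;
  by [apply: mU; apply: Kp_diag
     |apply: mI; rewrite ?pidealN; apply: Kp_upper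
     |apply: mM; rewrite ?pidealN; apply: Kp_lower].
Qed.

End Iwahori.

(** * The character of the inducing subgroup *)

Section Characters.
Variables (F : naLocalFieldType) (R : realType) (w t : F) (psi : F -> R[i]).
Hypotheses (hw : is_uniformizer w) (hpsi : is_character psi) (ht : lunit t).
Variable s : bool.
Local Notation G := (GSp4 F).
Implicit Types (g h k z : G) (x y : F) (n : int).

Local Notation H := (@Hgrp F).
Local Notation H' := (Hgrp' w t).
Local Notation gx := (gchi w t).

Let w0 : w != 0. Proof. by case: hw. Qed.
Let t0 : t != 0. Proof. by case: ht. Qed.

Definition ell k : F := gval k 0 1 + gval k 1 2 + t * w^-1 * gval k 3 0.

Lemma pideal_tw n x : pideal (n + 1) x -> pideal n (t * w^-1 * x).
Proof.
have [_ w1] := hw; have [_ tv] := ht.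
move=> /(pidealM (@pideal_lval F (t * w^-1))).
by rewrite lvalM ?invr_neq0// lvalV// w1 tv; apply: le_pideal; lia.
Qed.

Lemma ell_lint k : Kp k -> pideal 0 (ell k).
Proof.
move=> hk; do 2?apply: pidealD; try exact: Kp_upper.
by apply: pideal_tw; rewrite add0r; exact: Kp_lower.
Qed.

Lemma psi0D x y : psi0 psi w (x + y) = psi0 psi w x * psi0 psi w y.
Proof. by rewrite /psi0 mulrDr psiD. Qed.

Lemma psi0_lmax x : pideal 1 x -> psi0 psi w x = 1.
Proof.
have [_ w1] := hw.
move=> h; rewrite /psi0 psi_lint// mulrC pidealMr ?invr_neq0//.
by rewrite lvalV// w1.
Qed.

Lemma psi0_congr x y : pideal 1 (x - y) -> psi0 psi w x = psi0 psi w y.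
Proof. by move=> h; rewrite -(subrK y x) psi0D psi0_lmax// mul1r. Qed.

(** [chi] picks some decomposition. Two decompositions of one element differ by a scalar in 1 + p,
    which changes the integral value of [ell] by an element of p, where [psi0] is trivial. *)
Lemma chiE z k : Zc z -> Kp k -> chi psi w t (z * k)%g = psi0 psi w (ell k).
Proof.
move=> hz hk; rewrite /chi; case: xgetP => [[z' k'] _ [/= hz' hk' e]|/(_ (z, k))].
  have [c c0 zE] := (ZcP hw _).1 hz; have [c' c'0 z'E] := (ZcP hw _).1 hz'.
  have k'E : gval k' = (c / c') *: gval k.
    have := congr1 (fun g => gval g) e; rewrite /= zE z'E !mul_scalar_mx => e'.
    by rewrite mulrC -scalerA e' scalerA mulVf// scale1r.
  have c1 : lunit1 (c / c').
    have -> : c / c' = gval k' 3 3 / gval k 3 3.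
      by rewrite k'E mxE mulfK// lunit1_neq0//; exact: Kp_diag.
    by apply: lunit1_div; exact: Kp_diag.
  apply: psi0_congr; rewrite k'E !mxE.
  have -> : c / c' * gval k 0 1 + c / c' * gval k 1 2
    + t * w^-1 * (c / c' * gval k 3 0) - ell k = (c / c' - 1) * ell k.
    by rewrite /ell; ring.
  by rewrite -[1%R]addr0; apply: pidealM; [exact/lunit1P|exact: ell_lint].
by case.
Qed.

(** After 1 is subtracted from the diagonal entries, every remaining product in the first two
    entries has a factor in p. *)
Lemma ellM k k' : Kp k -> Kp k' -> pideal 1 (ell (k * k')%g - (ell k + ell k')).
Proof.
move=> hk hk'.
have pM01 x y : pideal 0 x -> pideal 1 y -> pideal 1 (x * y).
  by move=> hx hy; rewrite -[1%R]add0r; exact: pidealM.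
have pM10 x y : pideal 1 x -> pideal 0 y -> pideal 1 (x * y).
  by move=> hx hy; rewrite -[1%R]addr0; exact: pidealM.
have d1 (i : 'I_4) : pideal 1 (gval k i i - 1) by exact/lunit1P/Kp_diag.
have d1' (i : 'I_4) : pideal 1 (gval k' i i - 1) by exact/lunit1P/Kp_diag.
rewrite /ell /= !mxE !sum4.
have -> : gval k 0 0 * gval k' 0 1 + gval k 0 1 * gval k' 1 1
 + gval k 0 2 * gval k' 2 1 + gval k 0 3 * gval k' 3 1
 + (gval k 1 0 * gval k' 0 2 + gval k 1 1 * gval k' 1 2
    + gval k 1 2 * gval k' 2 2 + gval k 1 3 * gval k' 3 2)
 + t * w^-1 * (gval k 3 0 * gval k' 0 0 + gval k 3 1 * gval k' 1 0
    + gval k 3 2 * gval k' 2 0 + gval k 3 3 * gval k' 3 0)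
 - (gval k 0 1 + gval k 1 2 + t * w^-1 * gval k 3 0
    + (gval k' 0 1 + gval k' 1 2 + t * w^-1 * gval k' 3 0)) =
 (gval k 0 0 - 1) * gval k' 0 1 + gval k 0 1 * (gval k' 1 1 - 1)
 + gval k 0 2 * gval k' 2 1 + gval k 0 3 * gval k' 3 1
 + (gval k 1 0 * gval k' 0 2 + (gval k 1 1 - 1) * gval k' 1 2
    + gval k 1 2 * (gval k' 2 2 - 1) + gval k 1 3 * gval k' 3 2)
 + t * w^-1 * (gval k 3 0 * (gval k' 0 0 - 1) + gval k 3 1 * gval k' 1 0
    + gval k 3 2 * gval k' 2 0 + (gval k 3 3 - 1) * gval k' 3 0).
  by ring.
apply: pidealD; last first.
  (* The products in the entry (3, 0) lie in p^2, which compensates the factor [w^-1]. *)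
  apply: pideal_tw.
  by do !apply: pidealD; apply: pidealM; by [exact: Kp_lower|exact: d1|exact: d1'].
do !apply: pidealD;
  by [apply: pM10; [exact: d1|exact: Kp_upper]
     |apply: pM01; [exact: Kp_upper|exact: d1']
     |apply: pM01; [exact: Kp_upper|exact: Kp_lower]
     |apply: pM10; [exact: Kp_lower|exact: Kp_upper]].
Qed.

Lemma ZcM z z' : Zc z -> Zc z' -> Zc (z * z')%g.
Proof. by move=> hz hz' g; rewrite -mulgA hz' !mulgA hz. Qed.

Lemma ZcV z : Zc z -> Zc z^-1%g.
Proof.
by move=> hz g; apply: (mulgI z); rewrite mulVKg [RHS]mulgA hz mulgK.
Qed.

Lemma HgrpM h h' : H h -> H h' -> H (h * h')%g.
Proof.
move=> [z hz [k hk <-]] [z' hz' [k' hk' <-]].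
exists (z * z')%g; first exact: ZcM.
exists (k * k')%g; first exact: KpM.
by rewrite -!mulgA; congr (z * _)%g; rewrite !mulgA hz'.
Qed.

Lemma HgrpV h : H h -> H h^-1%g.
Proof.
move=> [z hz [k hk <-]]; exists z^-1%g; first exact: ZcV.
exists k^-1%g; first exact: KpV.
by rewrite invgM (ZcV hz).
Qed.

Lemma Hgrp_Kp k : Kp k -> H k.
Proof.
move=> hk; exists 1%g; first by move=> g; rewrite mul1g mulg1.
by exists k => //; rewrite mul1g.
Qed.

Lemma Hgrp_Zc z : Zc z -> H z.
Proof. by move=> hz; exists z => //; exists 1%g; [exact: Kp1|rewrite mulg1]. Qed.

Lemma chiM h h' : H h -> H h' ->
  chi psi w t (h * h')%g = chi psi w t h * chi psi w t h'.
Proof.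
move=> [z hz [k hk <-]] [z' hz' [k' hk' <-]].
have -> : (z * k * (z' * k') = (z * z') * (k * k'))%g.
  by rewrite -!mulgA; congr (z * _)%g; rewrite !mulgA hz'.
rewrite !chiE//; [|exact: ZcM|exact: KpM].
by rewrite -psi0D; apply/psi0_congr/ellM.
Qed.

Lemma norm_chi h : H h -> `|chi psi w t h| = 1.
Proof. by move=> [z hz [k hk <-]]; rewrite chiE// /psi0 norm_psi. Qed.

Lemma Zc_gchi2 : Zc (gx * gx)%g.
Proof.
apply/(ZcP hw); exists (- (w / t)).
  by rewrite oppr_eq0 mulf_neq0 ?invr_neq0.
rewrite /= gchiE// mx4M [RHS]mx4_eta !mxE /= ?mulr1n ?mulr0n.
by do ?[congr mx4 | congr cons]; ring.
Qed.

(** In the conjugated matrix, the factor w/t moves integral entries from above the diagonal to p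
    below it, and t/w moves entries of p from below the diagonal to integers above it. *)
Lemma gchi_conj_Hgrp h : H h -> H (gx * h * gx^-1)%g.
Proof.
move=> [z hz [k hk <-]]; exists z => //.
exists (gx * k * gx^-1)%g; last by rewrite !mulgA hz.
pose A := gval k.
have tw0 : w / t != 0 by rewrite mulf_neq0 ?invr_neq0.
pose B := mx4 [:: [:: A 2 2; - A 2 3; - (t / w) * A 2 0; t / w * A 2 1];
  [:: - A 3 2; A 3 3; t / w * A 3 0; - (t / w) * A 3 1];
  [:: - (w / t) * A 0 2; w / t * A 0 3; A 0 0; - A 0 1];
  [:: w / t * A 1 2; - (w / t) * A 1 3; - A 1 0; A 1 1]].
have gE : gval (gx * k * gx^-1)%g = B.
  (* The conjugate is identified without computing the inverse of [gx]. *)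
  have e : gval gx *m A = B *m gval gx.
    rewrite gchiE// [A]mx4_eta /B !mx4M.
    by do ?[congr mx4 | congr cons]; field; rewrite ?w0 ?t0.
  rewrite /= e -mulmxA (_ : gval gx *m _ = 1%:M) ?mulmx1//.
  exact: mulmxV (gsp_unit gx).
have wt x : pideal 0 x -> pideal 1 (w / t * x).
  have [_ w1] := hw; have [_ tv] := ht.
  rewrite -[1%R]addr0; apply: pidealM; right.
  by rewrite lvalM ?invr_neq0// lvalV// w1 tv subr0.
have tw x : pideal 1 x -> pideal 0 (t / w * x).
  by move=> hx; apply: pideal_tw; rewrite add0r.
move=> i j; rewrite gE; move: i j.
do 2!apply: ord4P; rewrite !mxE /= ?mulNr /lint /lmax ?pidealN;
  by [apply: Kp_diag|apply: Kp_upper|apply: Kp_lower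
     |apply: tw; apply: Kp_lower|apply: wt; apply: Kp_upper].
Qed.

(** As [gx * gx] lies in [H], conjugation by the inverse of [gx] is conjugation by [gx] followed by
    conjugation by an element of [H]. *)
Lemma gchi_conjV_Hgrp h : H h -> H (gx^-1 * h * gx)%g.
Proof.
move=> hh; have hZ := Hgrp_Zc Zc_gchi2.
have -> : (gx^-1 * h * gx = (gx * gx)^-1 * (gx * h * gx^-1) * (gx * gx))%g.
  by rewrite invgM -!mulgA !mulKg.
by apply: HgrpM => //; apply: HgrpM; [exact: HgrpV|exact: gchi_conj_Hgrp].
Qed.

Lemma Hgrp'_sub h : H h -> H' h.
Proof. by left. Qed.

(** [H] is normalized by [gx] and contains its square. *)
Lemma Hgrp'M h h' : H' h -> H' h' -> H' (h * h')%g.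
Proof.
move=> [hh|[h1 hh1 <-]] [hh'|[h1' hh1' <-]].
- by left; exact: HgrpM.
- right; exists (gx^-1 * h * gx * h1')%g; last by rewrite !mulgA mulgV mul1g.
  by apply: HgrpM => //; exact: gchi_conjV_Hgrp.
- by right; exists (h1 * h')%g; [exact: HgrpM|rewrite mulgA].
- left; have -> : (gx * h1 * (gx * h1') = (gx * gx) * ((gx^-1 * h1 * gx) * h1'))%g.
    by rewrite -!mulgA mulVKg.
  apply: HgrpM; first exact: Hgrp_Zc Zc_gchi2.
  by apply: HgrpM => //; exact: gchi_conjV_Hgrp.
Qed.

Lemma Hgrp'V h : H' h -> H' h^-1%g.
Proof.
move=> [hh|[h1 hh1 <-]]; first by left; exact: HgrpV.
right; exists ((gx * gx)^-1 * (gx * h1^-1 * gx^-1))%g; last first.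
  by rewrite !invgM -!mulgA mulVKg mulKg.
apply: HgrpM; first exact/HgrpV/Hgrp_Zc/Zc_gchi2.
exact/gchi_conj_Hgrp/HgrpV.
Qed.

Lemma Hgrp'_mull h g : H' h -> H' (h * g)%g <-> H' g.
Proof.
move=> hh; split=> [|hg]; last exact: Hgrp'M.
by move=> /(Hgrp'M (Hgrp'V hh)); rewrite mulKg.
Qed.

(** Right multiplication by [H] preserves each of the two cosets [H] and [gx H], so the claim
    reduces to the multiplicativity of [chi] on [H]. *)
Lemma chipmM h k : H' h -> H k ->
  chipm psi w t s (h * k)%g = chipm psi w t s h * chi psi w t k.
Proof.
move=> hh hk; rewrite /chipm; case: asboolP => hhk; case: asboolP => hH.
- exact: chiM.
- by case: hH; rewrite -(mulgK k h); apply: HgrpM => //; exact: HgrpV.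
- by case: hhk; exact: HgrpM.
- case: hh => [//|[h1 hh1 e]].
  by rewrite -e -!mulgA !mulKg chiM// mulrA.
Qed.

Lemma norm_chipm h : H' h -> `|chipm psi w t s h| = 1.
Proof.
rewrite /chipm; case: asboolP => [hh _|hH [//|[h1 hh1 <-]]].
  exact: norm_chi.
by rewrite mulKg normrM normr_sign mul1r norm_chi.
Qed.

(** The premise on [g] lets [chipmM] apply whenever [g] is in H'. For upper triangular [g] it is
    supplied by [upper_Hgrp]. *)
Lemma fmin_mull h g : H' h -> (H' g -> H g) ->
  fmin psi w t s (h * g)%g = chipm psi w t s h * fmin psi w t s g.
Proof.
move=> hh gH; rewrite /fmin; case: asboolP => hhg; case: asboolP => hg.
- by rewrite (chipmM hh (gH hg)) [in RHS]/chipm (asboolT (gH hg)).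
- by case: hg; apply/(Hgrp'_mull _ hh).
- by case: hhg; apply: Hgrp'M.
- by rewrite mulr0.
Qed.

Lemma fmin_Hgrp g : (H' g -> H g) ->
  fmin psi w t s g = if `[< H g >] then chi psi w t g else 0.
Proof.
move=> gH; rewrite /fmin /chipm; case: asboolP => [/gH|hg].
  by case: asboolP.
by case: asboolP => // /Hgrp'_sub.
Qed.

Lemma fmin_out g : ~ H' g -> fmin psi w t s g = 0.
Proof. by move=> hg; rewrite /fmin; case: asboolP. Qed.

Lemma fmin_in g : H' g -> fmin psi w t s g = chipm psi w t s g.
Proof. by move=> hg; rewrite /fmin; case: asboolP. Qed.

(* On [gchi H] the entry [(2, 0)] is a nonzero multiple of [k 0 0]. *)
Lemma upper_Hgrp g : gval g 2 0 = 0 -> H' g -> H g.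
Proof.
move=> g20 [//|[_ [z hz [k hk <-]] gE]]; exfalso.
have [c c0 zE] := (ZcP hw _).1 hz.
have /eqP : gval g 2 0 = - (w / t) * (c * gval k 0 0).
  rewrite -gE /= zE mul_scalar_mx gchiE// !mxE sum4 !mxE /=.
  by rewrite !mul0r !addr0.
rewrite g20 eq_sym !mulf_eq0 oppr_eq0 (negPf c0) mulf_eq0 invr_eq0.
by rewrite (negPf w0) (negPf t0) (negPf (lunit1_neq0 (Kp_diag 0 hk))).
Qed.

End Characters.

(** * Topology of the group *)

(** For every set, its preimage or the complement of that preimage lies in [U], so the image filter
    is maximal. This serves to extract limits of matrix entries. *)
Lemma ultra_fmap (T T' : Type) (f : T -> T') (U : set_system T) :
  UltraFilter U -> UltraFilter (f @ U).
Proof.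
move=> UU; split=> [|V VV fUV]; first exact: fmap_proper_filter.
apply/seteqP; split=> // A VA.
have [//|UnA] := in_ultra_setVsetC (f @^-1` A) UU.
have VnA : V (~` A) by apply: fUV.
by have /filter_ex[x []] : V (A `&` ~` A) by exact: filterI.
Qed.

Section MatrixIdeal.
Variable F : naLocalFieldType.
Implicit Types (n : int) (A B : 'M[F]_4).

Definition mxideal n A := forall i j : 'I_4, pideal n (A i j).

Lemma mxidealM m n A B : mxideal m A -> mxideal n B -> mxideal (m + n) (A *m B).
Proof.
by move=> hA hB i j; rewrite mxE; apply: pideal_sum => l _; apply: pidealM.
Qed.

Lemma mxidealD n A B : mxideal n A -> mxideal n B -> mxideal n (A + B).
Proof. by move=> hA hB i j; rewrite mxE; apply: pidealD. Qed.

Lemma mxideal_tr n A : mxideal n A -> mxideal n A^T.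
Proof. by move=> hA i j; rewrite mxE. Qed.

Lemma mxideal_J4 : mxideal 0 (J4 F).
Proof.
do 2!apply: ord4P; rewrite /J4 !mxE /= ?pidealN; by [exact: pideal0|exact: pideal1].
Qed.

Lemma mxideal_bound A : exists n, mxideal n A.
Proof.
exists (- (\sum_i \sum_j `|lval (A i j)|%N)%N%:Z) => i j; right.
suff : (`|lval (A i j)| <= \sum_i \sum_j `|lval (A i j)|)%N by lia.
by rewrite (bigD1 i)//= (bigD1 j)//= -addnA leq_addr.
Qed.

Lemma Kp_mxideal (k : GSp4 F) : Kp k -> mxideal 0 (gval k).
Proof.
move=> /KpP hk i j; rewrite -(subrK (i == j)%:R (gval k i j)).
apply: pidealD; first by apply: le_pideal (hk i j); lia.
by case: (i == j); [exact: pideal1|exact: pideal0].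
Qed.

(** Telescoping gives two products, each with the factor [A - B] or its transpose. The similitude
    equation can thereby pass to limits. *)
Lemma similitude_congr n A B : mxideal 0 A -> mxideal 0 B -> mxideal n (A - B) ->
  mxideal n (A^T *m J4 F *m A - B^T *m J4 F *m B).
Proof.
move=> hA hB hAB.
have -> : A^T *m J4 F *m A - B^T *m J4 F *m B =
    (A - B)^T *m J4 F *m A + B^T *m J4 F *m (A - B).
  by rewrite (linearB trmx) !mulmxBl mulmxBr addrA subrK.
have hJ := mxideal_J4; apply: mxidealD.
  by rewrite -[n]addr0 -[n]addr0; do 2!apply: mxidealM => //; exact: mxideal_tr.
rewrite -[n]add0r; apply: mxidealM => //.
by rewrite -[0]add0r; apply: mxidealM => //; exact: mxideal_tr.
Qed.

End MatrixIdeal.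

Section GspTopology.
Variable F : naLocalFieldType.
Local Notation G := (GSp4 F).
Implicit Types (g h k z : G) (n : int).

Lemma nbhs_gspP g (S : set G) : nbhs g S <->
  exists n, forall h, mxideal n (gval h - gval g) -> S h.
Proof.
split=> [[_ [[B oB <-] Bg BS]]|[n nS]].
  have [P Pg PB] : nbhs (gval g) B by apply: open_nbhs_nbhs.
  have /choice[N hN] (ij : 'I_4 * 'I_4) :
      exists n, forall y, pideal n (y - gval g ij.1 ij.2) -> P ij.1 ij.2 y.
    exact: (nbhs_pidealP _ _).1 (Pg _ _).
  (* One exponent serves all sixteen entries. *)
  exists (\sum_ij `|N ij|%N)%N%:Z => h hh; apply/BS/PB => i j.
  apply: (hN (i, j)) => /=; have := hh i j; rewrite !mxE; apply: le_pideal.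
  suff : (`|N (i, j)| <= \sum_ij `|N ij|)%N by lia.
  by rewrite (bigD1 (i, j))//= leq_addr.
apply: filterS nS _.
have : nbhs (gval g) [set A | mxideal n (A - gval g)].
  exists (fun i j => [set y | pideal n (y - gval g i j)]).
    by move=> i j; exact: nbhs_pideal.
  by move=> A hA i j; rewrite !mxE; exact: hA.
exact: initial_continuous.
Qed.

(** An ultrafilter on K' converges entry by entry, by compactness of the integers. The limit matrix
    inherits the congruence conditions, and it satisfies the similitude equation modulo every p^n,
    hence exactly. *)
Lemma Kp_compact : compact (@Kp F).
Proof.
rewrite compact_ultra => U UU UK.
have UI (A B : set G) : U A -> U B -> U (A `&` B) by exact: filterI.
have lim_entry (ij : 'I_4 * 'I_4) : exists l : F,
    forall n, U [set g | pideal n (gval g ij.1 ij.2 - l)].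
  have := @pideal_compact F 0; rewrite compact_ultra.
  move=> /(_ ((fun g : G => gval g ij.1 ij.2) @ U)) [].
  - exact: ultra_fmap.
  - rewrite /fmap /=; apply: (@filterS _ U _ _ _ _ UK) => k /Kp_mxideal hk; exact: hk.
  - move=> l [_ Ul]; exists l => n; exact: (Ul _ (nbhs_pideal l n)).
have {lim_entry}[l hl] := choice lim_entry.
pose L : 'M[F]_4 := \matrix_(i, j) l (i, j).
have UL n : U [set g | mxideal n (gval g - L)].
  have UA : U [set g | forall ij, pideal n (gval g ij.1 ij.2 - l ij)].
    exact: filter_forall (hl ^~ n).
  by apply: filterS UA => g hg i j; rewrite !mxE; exact: (hg (i, j)).
have near_L n : exists2 k, Kp k & mxideal n (gval k - L).
  by have /filter_ex[k [? ?]] := UI _ _ UK (UL n); exists k.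
have LK : forall i j : 'I_4, if (i < j)%N then lint (L i j)
    else if i == j then lunit1 (L i j) else lmax (L i j).
  have [k hk kL] := near_L 1; move=> i j; have := hk i j; have := kL i j.
  rewrite [X in pideal 1 X]mxE [X in pideal 1 (_ + X)]mxE; move: (gval k i j) => x xL.
  have -> : L i j = x - (x - L i j) by ring.
  case: ifP => _; first by move=> hx; apply: pidealB => //; apply: le_pideal xL.
  case: ifP => _; last by move=> hx; apply: pidealB.
  by move=> hx; apply: lunit1D => //; apply/pidealN.
have L0 : mxideal 0 L.
  have [k /Kp_mxideal hk kL] := near_L 0.
  rewrite -[L](subKr (gval k)) => i j; rewrite mxE.
  by apply: pidealD => //; rewrite mxE; apply/pidealN.
have LE : L^T *m J4 F *m L = gmult L *: J4 F.
  apply/matrixP => i j; apply/eqP; rewrite -subr_eq0; apply/eqP.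
  apply: pideal_eq0 => n; have [k hk kL] := near_L n.
  have {}kL : mxideal n (L - gval k).
    by move=> a b; rewrite -opprB mxE; apply/pidealN.
  have hc := similitude_congr L0 (Kp_mxideal hk) kL.
  have := hc 0 3; rewrite mxE [X in _ + X]mxE -![(_ *m _) 0 3]/(gmult _) => hm.
  have := hc i j; rewrite [X in pideal n X]mxE [X in pideal n (_ + X)]mxE gsp_gmult.
  move=> h; have := pidealM hm (mxideal_J4 F i j); rewrite addr0 => /(pidealB h).
  by rewrite !mxE; congr (pideal n _); ring.
(* The multiplier of the limit is in 1 + p, hence nonzero, so the limit stays in the group and
   [toGSp4] returns it unchanged. *)
have m1 : lunit1 (gmult L) by exact: lunit1_gmult.
have gE : gval (toGSp4 L) = L := toGSp4E (lunit1_neq0 m1) LE.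
exists (toGSp4 L); split; first by move=> i j; rewrite gE; exact: LK.
by move=> A /nbhs_gspP[n nA]; apply: filterS (UL n) => g hg; apply: nA; rewrite gE.
Qed.

(** If the entries of g^-1 lie in p^m and h is congruent to g modulo p^(1-m), then g^-1 h is
    congruent to 1 modulo p and so lies in K'. *)
Lemma Kp_stable_open (S : set G) :
  (forall g k, S g -> Kp k -> S (g * k)%g) -> open S.
Proof.
move=> SK; rewrite openE => g Sg; apply/nbhs_gspP.
have [m mg] := mxideal_bound (gval (g^-1)%g).
exists (1 - m) => h hh; rewrite -(mulVKg g h); apply: SK => //.
apply/KpP => i j.
have -> : gval (g^-1 * h)%g i j - (i == j)%:R =
    (gval (g^-1)%g *m (gval h - gval g)) i j.
  rewrite mulmxBr (_ : gval (g^-1)%g *m gval g = 1%:M) ?mxE//.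
  exact: mulVmx (gsp_unit g).
apply: le_pideal (mxidealM mg hh i j); lia.
Qed.

End GspTopology.

(** * Matrix coefficients of the minimal vector *)

Lemma cintegral_indic d (T : measurableType d) (R : realType)
    (m : {measure set T -> \bar R}) (D : set T) (c : R[i]) : measurable D ->
  cintegral m (fun x => if `[< D x >] then c else 0) = c * (fine (m D))%:C%C.
Proof.
move=> mD; rewrite /cintegral.
have int_re (r : R) : \int[m]_x (if `[< D x >] then r else 0) = r * fine (m D).
  rewrite -Rintegral_cst// [RHS]Rintegral_mkcond; apply: eq_Rintegral => x _.
  by rewrite /patch; congr (if _ then _ else _); apply/idP/idP; rewrite inE => /asboolP.
transitivity (Complex (complex.Re c * fine (m D)) (complex.Im c * fine (m D))).
  by congr Complex; rewrite -int_re; apply: eq_Rintegral => x _; case: ifP.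
by case: c => a b; apply/eqP; rewrite eq_complex /= !mulr0 subr0 add0r !eqxx.
Qed.

(** * The quotient by the center *)

Section Quotient.
Local Open Scope quotient_scope.
Variable F : naLocalFieldType.
Local Notation G := (GSp4 F).
Implicit Types (g h k z : G) (S : set G).

Lemma pi_ZGP g h : \pi_(ZG F) g = \pi_(ZG F) h <-> exists2 z, Zc z & g = (z * h)%g.
Proof.
split=> [e|e]; last by apply/eqmodP/asboolP.
by have /eqmodP/asboolP := e.
Qed.

Definition ZGimage S : set (ZG F) := [set \pi_(ZG F) h | h in S].

Lemma ZGimageP S g : (forall z h, Zc z -> S h -> S (z * h)%g) ->
  ZGimage S (\pi_(ZG F) g) <-> S g.
Proof.
move=> ZS; split=> [[h hS /esym/pi_ZGP[z hz ->]]|]; first exact: ZS.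
by move=> gS; exists g.
Qed.

Lemma ZGimage_repr S y : (forall z h, Zc z -> S h -> S (z * h)%g) ->
  ZGimage S y <-> S (repr y).
Proof. by move=> ZS; rewrite -{1}[y]reprK; exact: ZGimageP. Qed.

Lemma ZGimage_open S : (forall z h, Zc z -> S h -> S (z * h)%g) ->
  open S -> open (ZGimage S).
Proof.
move=> ZS oS; rewrite /open /= /quotient_open (_ : _ @^-1` _ = S)//.
by apply/seteqP; split=> g /(ZGimageP _ ZS).
Qed.

(** [ZGtrans] acts through a chosen representative; stability of [S] under the center makes the
    preimage independent of that choice. *)
Lemma ZGtrans_image S x : (forall z h, Zc z -> S h -> S (z * h)%g) ->
  ZGtrans x @^-1` ZGimage S = ZGimage [set g | S (g * x)%g].
Proof.
move=> ZS; apply/seteqP; split=> y.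
  move=> /(ZGimageP _ ZS) h; apply/ZGimage_repr => // z g hz /= hg.
  by rewrite -mulgA; exact: ZS.
move=> /ZGimage_repr h; apply/(ZGimageP _ ZS); apply: h => z g hz /= hg.
by rewrite -mulgA; exact: ZS.
Qed.

Lemma open_rtrans S x : open S -> open [set g | S (g * x)%g].
Proof.
rewrite !openE => oS g /= /oS /nbhs_gspP[n nS]; apply/nbhs_gspP.
have [m mx] := mxideal_bound (gval x); exists (n - m) => h hh; apply: nS => /=.
by rewrite -mulmxBl -[n](subrK m); exact: mxidealM.
Qed.

(** The center disappears in the quotient, so finiteness of the measure of this image will follow
    from the compactness of K'. *)
Lemma ZGimage_Hgrp : ZGimage (@Hgrp F) = ZGimage (@Kp F).
Proof.
apply/seteqP; split=> _ [h hh <-]; last by exists h => //; exact: Hgrp_Kp.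
move: hh => [z hz [k hk <-]]; exists k => //; apply/pi_ZGP; exists z^-1%g.
  exact: ZcV.
by rewrite mulKg.
Qed.

Lemma ZGimage_Kp_compact : compact (ZGimage (@Kp F)).
Proof.
apply: continuous_compact; last exact: Kp_compact.
apply: continuous_subspaceT; exact: pi_continuous.
Qed.

End Quotient.

(** * Inner products of translates of the minimal vector *)

Section Inner.
Local Open Scope quotient_scope.
Variables (F : naLocalFieldType) (R : realType) (w t : F) (psi : F -> R[i]).
Hypotheses (hw : is_uniformizer w) (hpsi : is_character psi) (ht : lunit t).
Variable s : bool.
Variable nu : {measure set (borel (ZG F)) -> \bar R}.
Hypothesis hnu : is_haar (@ZGtrans F) nu.
Local Notation G := (GSp4 F).
Local Notation f := (fmin psi w t s).
Implicit Types (g h k z : G).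

Lemma Zc_Hgrp z h : Zc z -> Hgrp h -> Hgrp (z * h)%g.
Proof. by move=> hz; apply: HgrpM; exact: Hgrp_Zc. Qed.

Lemma Zc_Hgrp' z h : Zc z -> Hgrp' w t h -> Hgrp' w t (z * h)%g.
Proof. by move=> hz; apply: Hgrp'M => //; left; exact: Hgrp_Zc. Qed.

Lemma open_Hgrp : open (@Hgrp F).
Proof.
by apply: Kp_stable_open => g k hg hk; apply: HgrpM => //; exact: Hgrp_Kp.
Qed.

Lemma open_Hgrp' : open (Hgrp' w t).
Proof.
apply: Kp_stable_open => g k hg hk; apply: Hgrp'M => //.
by left; exact: Hgrp_Kp.
Qed.

Lemma measurable_ZGimage (S : set G) :
    (forall z h, Zc z -> S h -> S (z * h)%g) -> open S ->
  measurable (ZGimage S : set (borel (ZG F))).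
Proof. by move=> ZS oS; apply: sub_sigma_algebra; exact: ZGimage_open. Qed.

Lemma measurable_ZGimage_Hgrp' :
  measurable (ZGimage (Hgrp' w t) : set (borel (ZG F))).
Proof. exact: (measurable_ZGimage Zc_Hgrp' open_Hgrp'). Qed.

(** Since [gx] normalizes [H], the coset [gx H] equals [H gx], whose image is a right translate of
    the image of [H]. By invariance both images have the same finite measure. *)
Lemma nu_Hgrp'_fin : (nu (ZGimage (Hgrp' w t)) < +oo)%E.
Proof.
have [nuT nuK _] := hnu.
have mH : measurable (ZGimage (@Hgrp F) : set (borel (ZG F))).
  exact: (measurable_ZGimage Zc_Hgrp open_Hgrp).
have nuH : (nu (ZGimage (@Hgrp F)) < +oo)%E.
  by rewrite ZGimage_Hgrp; apply: nuK; exact: ZGimage_Kp_compact.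
pose x := (gchi w t)^-1%g.
pose A : set (borel (ZG F)) := ZGtrans x @^-1` ZGimage (@Hgrp F).
have mA : measurable A.
  rewrite /A ZGtrans_image; last exact: Zc_Hgrp.
  apply: measurable_ZGimage; last by apply: open_rtrans; exact: open_Hgrp.
  by move=> z h hz /= hh; rewrite -mulgA; exact: Zc_Hgrp.
apply: (@le_lt_trans _ _ (nu (ZGimage (@Hgrp F)) + nu A)%E).
  rewrite (_ : ZGimage (Hgrp' w t) = (ZGimage (@Hgrp F) `|` A : set (borel (ZG F)))).
    exact: measureU2.
  have ZA z h : Zc z -> [set g | Hgrp (g * x)%g] h ->
      [set g | Hgrp (g * x)%g] (z * h)%g.
    by move=> hz /= hh; rewrite -mulgA; exact: Zc_Hgrp.
  rewrite /A ZGtrans_image; last exact: Zc_Hgrp.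
  apply/seteqP; split=> y.
    move=> [h [hh|[k hk <-]] <-]; first by left; exists h.
    by right; exists (gchi w t * k)%g => //=; exact: gchi_conj_Hgrp.
  move=> [] [h hh <-]; exists h => //; first by left.
  right; exists (x * h)%g; last by rewrite mulVKg.
  have := gchi_conjV_Hgrp hw ht hh; by rewrite -!mulgA mulVg mulg1.
by rewrite lte_add_pinfty// /A nuT.
Qed.

Lemma nu_Hgrp'_gt0 : (0 < nu (ZGimage (Hgrp' w t)))%E.
Proof.
have [_ _ nuO] := hnu; apply: nuO; first exact: ZGimage_open Zc_Hgrp' open_Hgrp'.
by exists (\pi_(ZG F) 1%g); exists 1%g => //; left; apply: Hgrp_Kp; exact: Kp1.
Qed.

(** With h the translate of a point by [x2], the integrand is f(h g) times the conjugate of f(h). It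
    equals f(g) for h in H', because the character has absolute value 1 there, and vanishes
    elsewhere; the volume of H' modulo Z cancels the normalization. *)
Lemma inner_rtrans (x1 x2 : G) (g := (x2^-1 * x1)%g) :
    (Hgrp' w t g -> Hgrp g) ->
  inner w t nu (rtrans x1 f) (rtrans x2 f) = f g.
Proof.
move=> gH; rewrite /inner.
pose D : set (borel (ZG F)) := ZGtrans x2 @^-1` ZGimage (Hgrp' w t).
have DE y : D y <-> Hgrp' w t (repr y * x2)%g.
  rewrite /D ZGtrans_image; last exact: Zc_Hgrp'.
  apply: ZGimage_repr => z h hz /= hh; rewrite -mulgA; exact: Zc_Hgrp'.
have mD : measurable D.
  rewrite /D ZGtrans_image; last exact: Zc_Hgrp'.
  apply: measurable_ZGimage; last by apply: open_rtrans; exact: open_Hgrp'.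
  by move=> z h hz /= hh; rewrite -mulgA; exact: Zc_Hgrp'.
rewrite -/(ZGimage _) (_ : (fun _ => _) =
    (fun y => if `[< D y >] then f g else 0)); last first.
  apply/funext => y; rewrite /rtrans; case: asboolP => [/DE hy|hy].
    have -> : (repr y * x1 = repr y * x2 * g)%g by rewrite -mulgA mulVKg.
    rewrite fmin_mull// [f (repr y * x2)%g]fmin_in// mulrAC -normCK norm_chipm//.
    by rewrite expr1n mul1r.
  by rewrite [X in _ * X^*]fmin_out ?rmorph0 ?mulr0// => /DE.
have [nuT _ _] := hnu.
have nuD : nu D = nu (ZGimage (Hgrp' w t)).
  by apply: nuT; exact: measurable_ZGimage_Hgrp'.
have nu0 : fine (nu (ZGimage (Hgrp' w t))) != 0.
  by rewrite gt_eqF// fine_gt0// nu_Hgrp'_gt0; exact: nu_Hgrp'_fin.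
rewrite cintegral_indic// nuD mulrCA -rmorphM.
by rewrite mulVf// rmorph1 mulr1.
Qed.

End Inner.

(** * The minimal vector on conjugated unipotent elements *)

Section TorusConjugate.
Variables (F : naLocalFieldType) (R : realType) (w t : F) (psi : F -> R[i]).
Hypotheses (hw : is_uniformizer w) (hpsi : is_character psi) (ht : lunit t).
Variable s : bool.
Local Notation G := (GSp4 F).

(** The entry (3, 3) determines the central factor as the inverse of an element of 1 + p, and such a
    scalar preserves the conditions defining K'. *)
Lemma Hgrp_normalized (g : G) : gval g 3 3 = 1 -> Hgrp g -> Kp g.
Proof.
move=> g33 [z hz [k hk gE]]; have [c c0 zE] := (ZcP hw _).1 hz.
have {}gE : gval g = c *: gval k by rewrite -gE /= zE mul_scalar_mx.
have k33 := Kp_diag 3 hk.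
have c1 : lunit1 c.
  have -> : c = (gval k 3 3)^-1.
    by apply: (mulIf (lunit1_neq0 k33)); rewrite mulVf ?lunit1_neq0// -g33 gE mxE.
  exact: lunit1V.
move=> i j; have := hk i j; rewrite gE mxE; case: ifP => _.
  by move=> h; rewrite /lint -[0]add0r; apply: pidealM => //; exact: lunit1_int.
case: ifP => _; first exact: lunit1M.
by move=> h; rewrite /lmax -[1%R]add0r; apply: pidealM => //; exact: lunit1_int.
Qed.

Lemma fmin_normalized (g : G) : gval g 3 3 = 1 -> gval g 2 0 = 0 ->
  fmin psi w t s g = if `[< Kp g >] then psi0 psi w (ell w t g) else 0.
Proof.
move=> g33 g20; rewrite fmin_Hgrp; last exact: upper_Hgrp.
case: asboolP => [/(Hgrp_normalized g33) hk|hg].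
  by rewrite asboolT// -[in LHS](mul1g g) chiE// => h; rewrite mul1g mulg1.
by case: asboolP => // /(@Hgrp_Kp F).
Qed.

Variables (a b g d : F).
Hypotheses (ha : a != 0) (hb : b != 0) (hg : g != 0) (hd : d != 0).

Definition dud (x y z v : F) : G := ((dmat g d)^-1 * (umat x y z v * dmat a b))%g.

Lemma dudE x y z v : gval (dud x y z v) = mx4
  [:: [:: a ^+ 2 * b / (g ^+ 2 * d); x * a * b / (g ^+ 2 * d);
          (y + x * v) * a / (g ^+ 2 * d); (z + x * y) / (g ^+ 2 * d)];
      [:: 0; a * b / (g * d); v * a / (g * d); y / (g * d)];
      [:: 0; 0; a / g; - x / g];
      [:: 0; 0; 0; 1]].
Proof.
set M := mx4 _.
(* Multiplying by [dmat g d] on the left avoids its inverse. *)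
have e : gval (dmat g d) *m M = gval (umat x y z v) *m gval (dmat a b).
  rewrite /M !dmatE// umatE !mx4M.
  by do ?[congr mx4 | congr cons]; field; rewrite ?hg ?hd.
rewrite /dud /= -e mulmxA (_ : _ *m gval (dmat g d) = 1%:M) ?mul1mx//.
exact: mulVmx (gsp_unit _).
Qed.

(** The diagonal entries (1, 1) and (2, 2) are ab/(gd) and a/g. For an element of K' both are in 1 +
    p, and so is their quotient b/d. *)
Lemma fmin_dud_eq0 x y z v : ~ (lunit1 (a / g) /\ lunit1 (b / d)) ->
  fmin psi w t s (dud x y z v) = 0.
Proof.
move=> h; rewrite fmin_normalized; try by rewrite dudE mxE.
case: asboolP => // hk; case: h.
have := Kp_diag 2 hk; have := Kp_diag 1 hk; rewrite dudE !mxE /= => h1 h2.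
split=> //; rewrite (_ : b / d = (a * b / (g * d)) / (a / g)).
  exact: lunit1_div.
by field; rewrite ?ha ?hg ?hd.
Qed.

(** In coordinates (x, y, z, v), the condition that [x / g], [y / (g * d)], [z / (g ^+ 2 * d)] and
    [v / d] are integral. *)
Definition box : set (F * F * F * F) :=
  pideal (lval g) `*` pideal (lval (g * d)) `*` pideal (lval (g ^+ 2 * d))
  `*` pideal (lval d).

Lemma pideal_div n (x y : F) : y != 0 -> pideal n (x / y) <-> pideal (n + lval y) x.
Proof. by move=> y0; rewrite pidealMr ?invr_neq0// lvalV// opprK. Qed.

Hypotheses (ag : lunit1 (a / g)) (bd : lunit1 (b / d)).

Lemma pideal_lunit1 n (x u : F) : lunit1 u -> pideal n (x * u) <-> pideal n x.
Proof. by move=> hu; rewrite pidealMr ?lunit1_neq0// lval_lunit1// subr0. Qed.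

(** Up to sign and a factor in 1 + p, each entry above the diagonal is one of the four quotients of
    the box, or such a quotient plus a product of two others. All are therefore integral exactly on
    the box. *)
Lemma Kp_dud x y z v : Kp (dud x y z v) <-> box (x, y, z, v).
Proof.
have gd0 : g * d != 0 by rewrite mulf_neq0.
have g2d0 : g ^+ 2 * d != 0 by rewrite mulf_neq0 ?expf_neq0.
have e13 : x * a * b / (g ^+ 2 * d) = x / g * (a / g * (b / d)).
  by field; rewrite ?hg ?hd.
have e23 : v * a / (g * d) = v / d * (a / g) by field; rewrite ?hg ?hd.
have e02 : (y + x * v) * a / (g ^+ 2 * d) = (y / (g * d) + x / g * (v / d)) * (a / g).
  by field; rewrite ?hg ?hd.
have e03 : (z + x * y) / (g ^+ 2 * d) = z / (g ^+ 2 * d) + x / g * (y / (g * d)).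
  by field; rewrite ?hg ?hd.
have ab : lunit1 (a / g * (b / d)) by exact: lunit1M.
have boxE : box (x, y, z, v) <-> [/\ pideal 0 (x / g), pideal 0 (y / (g * d)),
    pideal 0 (z / (g ^+ 2 * d)) & pideal 0 (v / d)].
  have pd (p r : F) : r != 0 -> pideal 0 (p / r) = pideal (lval r) p.
    by move=> r0; apply/propext; rewrite pideal_div// add0r.
  by rewrite !pd//; split=> [[[[]]]|[]].
rewrite boxE; split=> [hk|[hx hy hz hv] i j].
  have := @Kp_upper _ _ 0 1 hk isT.
  have := @Kp_upper _ _ 1 3 hk isT.
  have := @Kp_upper _ _ 0 3 hk isT.
  have := @Kp_upper _ _ 1 2 hk isT.
  rewrite dudE !mxE /= e13 e23 e03.
  move=> /(pideal_lunit1 _ _ ag) hv hz hy /(pideal_lunit1 _ _ ab) hx; split=> //.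
  rewrite -[z / _](addrK (x / g * (y / (g * d)))); apply: pidealB => //.
  by rewrite -[0]add0r; apply: pidealM.
have xy : pideal 0 (x / g * (y / (g * d))) by rewrite -[0]add0r; apply: pidealM.
have xv : pideal 0 (x / g * (v / d)) by rewrite -[0]add0r; apply: pidealM.
move: i j; rewrite dudE; do 2!apply: ord4P; rewrite !mxE /= ?e13 ?e23 ?e02 ?e03;
  rewrite /lint /lmax //.
- rewrite (_ : _ / _ = a / g * (a / g * (b / d))); first exact: lunit1M.
  by field; rewrite ?hg ?hd.
- exact/pideal_lunit1.
- by apply/pideal_lunit1 => //; exact: pidealD.
- exact: pidealD.
- rewrite (_ : _ / _ = a / g * (b / d))//.
  by field; rewrite ?hg ?hd.
- exact/pideal_lunit1.
- by rewrite mulNr; apply/pidealN.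
- exact: lunit1_one.
Qed.

(** On the box, replacing a/g and b/d by 1 changes [ell] by an element of p, where [psi0] is
    trivial; the entry (3, 0) is zero. *)
Lemma fmin_dud x y z v : fmin psi w t s (dud x y z v) =
  if `[< box (x, y, z, v) >] then psi (w^-1 / g * x + w^-1 / d * v) else 0.
Proof.
have [w0 _] := hw.
rewrite fmin_normalized; try by rewrite dudE mxE.
rewrite (_ : `[< Kp _ >] = `[< box (x, y, z, v) >]); last exact/asbool_equiv_eq/Kp_dud.
case: asboolP => // -[[[/= hx _] _] hv].
transitivity (psi0 psi w (x / g + v / d)); last first.
  by rewrite /psi0; congr psi; ring.
apply: psi0_congr => //; rewrite /ell dudE !mxE /= mulr0 addr0.
have -> : x * a * b / (g ^+ 2 * d) + v * a / (g * d) - (x / g + v / d) =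
    (a / g * (b / d) - 1) * (x / g) + (a / g - 1) * (v / d).
  by field; rewrite ?hg ?hd.
have hx' : pideal 0 (x / g) by apply/pideal_div; rewrite ?add0r.
have hv' : pideal 0 (v / d) by apply/pideal_div; rewrite ?add0r.
by apply: pidealD; rewrite -[1%R]addr0; apply: pidealM => //; apply/lunit1P => //;
  exact: lunit1M.
Qed.

End TorusConjugate.

(** * Haar integrals *)

(** The section at x of the preimage of [A] is the preimage under [f2] of the section of [A] at
    f1(x). Invariance of [m2] removes [f2]; a change of variables and invariance of [m1] then remove
    [f1]. *)
Lemma product_measure_invariant d1 d2 (T1 : measurableType d1)
    (T2 : measurableType d2) (R : realType)
    (m1 : {measure set T1 -> \bar R})
    (m2 : {sigma_finite_measure set T2 -> \bar R})
    (f1 : T1 -> T1) (f2 : T2 -> T2) :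
    measurable_fun setT f1 -> measurable_fun setT f2 ->
    (forall A, measurable A -> m1 (f1 @^-1` A) = m1 A) ->
    (forall A, measurable A -> m2 (f2 @^-1` A) = m2 A) ->
  let f x := (f1 x.1, f2 x.2) in
  measurable_fun setT f /\
  forall A, measurable A -> (m1 \x m2)%E (f @^-1` A) = (m1 \x m2)%E A.
Proof.
move=> mf1 mf2 inv1 inv2 f.
have mf : measurable_fun setT f.
  apply: measurable_fun_pair.
    exact: measurableT_comp.
  exact: measurableT_comp.
split=> // A mA.
pose k := (m2 \o xsection A)%E.
have mk : measurable_fun setT k by exact: measurable_fun_xsection.
rewrite /product_measure1.
have e : forall x, (m2 \o xsection (f @^-1` A)) x = (k \o f1) x.
  move=> x; apply: etrans (inv2 _ (measurable_xsection (f1 x) mA)).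
  by congr (m2 _); apply/seteqP; split=> y /=; rewrite /xsection /= !inE.
under eq_integral do rewrite e.
have k0 : {in setT, forall y, (0 <= k y)%E} by move=> y _; exact: measure_ge0.
apply: (etrans (esym (ge0_integral_pushforward mf1 m1 measurableT mk k0))).
by apply: eq_measure_integral => B mB _; exact: inv1.
Qed.

(** * Complex-valued integrals *)

Section ComplexIntegral.
Context d (T : measurableType d) (R : realType).
Variable m : {measure set T -> \bar R}.

Definition cintegrable (f : T -> R[i]) :=
  m.-integrable setT (fun x => (complex.Re (f x))%:E) /\
  m.-integrable setT (fun x => (complex.Im (f x))%:E).

Let ReM (c z : R[i]) : complex.Re (c * z) =
  complex.Re c * complex.Re z - complex.Im c * complex.Im z.
Proof. by case: c z => ? ? []. Qed.

Let ImM (c z : R[i]) : complex.Im (c * z) =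
  complex.Re c * complex.Im z + complex.Im c * complex.Re z.
Proof. by case: c z => ? ? []. Qed.

Let integrable_scale (k : R) (h : T -> R) : m.-integrable setT (EFin \o h) ->
  m.-integrable setT (EFin \o (fun x => k * h x)).
Proof.
move=> hi; rewrite (_ : _ \o _ = (fun x => k%:E * (EFin \o h) x)%E).
  exact: integrableZl.
exact/funext.
Qed.

Lemma cintegrableZ (c : R[i]) f : cintegrable f -> cintegrable (fun x => c * f x).
Proof.
move=> [fR fI]; split.
  rewrite (_ : (fun _ => _) = (EFin \o (fun x => complex.Re c * complex.Re (f x))%R)
      \- (EFin \o (fun x => complex.Im c * complex.Im (f x))%R))%E.
    by apply: integrableB => //; exact: integrable_scale.
  by apply/funext => x; rewrite ReM.
rewrite (_ : (fun _ => _) = (EFin \o (fun x => complex.Re c * complex.Im (f x))%R)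
    \+ (EFin \o (fun x => complex.Im c * complex.Re (f x))%R))%E.
  by apply: integrableD => //; exact: integrable_scale.
by apply/funext => x; rewrite ImM.
Qed.

Lemma cintegralZ (c : R[i]) f : cintegrable f ->
  cintegral m (fun x => c * f x) = c * cintegral m f.
Proof.
move=> [fR fI]; rewrite /cintegral.
under eq_Rintegral do rewrite ReM.
under [X in Complex _ X]eq_Rintegral do rewrite ImM.
rewrite RintegralB ?RintegralD ?RintegralZl//; try exact: integrable_scale.
by case: c.
Qed.

Lemma cintegral_invariant (T0 : T -> T) (f : T -> R[i]) :
    measurable_fun setT T0 ->
    (forall A, measurable A -> m (T0 @^-1` A) = m A) ->
    cintegrable f -> cintegrable (f \o T0) ->
  cintegral m (f \o T0) = cintegral m f.
Proof.
move=> mT inv [fR fI] [gR gI]; rewrite /cintegral /Rintegral.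
have h (k : T -> \bar R) : m.-integrable setT k -> m.-integrable setT (k \o T0) ->
    (\int[m]_x (k (T0 x)) = \int[m]_x k x)%E.
  move=> ki kTi.
  have e := integral_pushforward mT (measurable_int _ ki) kTi measurableT.
  apply: (etrans (esym e)).
  by apply: eq_measure_integral => A mA _; exact: inv.
by rewrite (h _ fR gR) (h _ fI gI).
Qed.

End ComplexIntegral.

(** * Volumes of fractional ideals *)

Section Haar.
Variables (F : naLocalFieldType) (R : realType).
Variable mu : {sigma_finite_measure set (borelF F) -> \bar R}.
Hypothesis hmu : is_haar (fun y x : pointed_lfield F => (x + y : F)) mu.
Hypothesis hmu1 : mu lint = 1%E.

Definition translate (y : F) : borelF F -> borelF F := fun x => (x : F) + y.

Lemma measurable_open (A : set F) : open A -> measurable (A : set (borelF F)).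
Proof. by move=> oA; exact: sub_sigma_algebra. Qed.

Lemma measurable_pideal n : measurable (pideal n : set (borelF F)).
Proof.
apply: measurable_open; have := pideal_open n (0 : F).
by congr open; apply/seteqP; split=> x /=; rewrite subr0.
Qed.

Lemma mu_translate y A : measurable A -> mu (translate y @^-1` A) = mu A.
Proof. by case: hmu => h _ _; exact: h. Qed.

Lemma open_translate y (A : set F) : open A -> open [set x | A (x + y)].
Proof.
rewrite !openE => oA x /= /oA /nbhs_pidealP[n nA]; apply/nbhs_pidealP.
by exists n => z zx; apply: nA; rewrite opprD addrACA subrr addr0.
Qed.

Lemma measurable_translate y : measurable_fun setT (translate y).
Proof.
apply: (@measurability _ _ (borelF F) (borelF F) _ _ (@open (pointed_lfield F))) => //.
move=> _ [A oA <-]; rewrite setTI; apply: measurable_open.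
exact: open_translate.
Qed.

Lemma mu_pideal_fin n : (mu (pideal n) < +oo)%E.
Proof. by case: hmu => _ h _; apply: h; exact: pideal_compact. Qed.

(** The ideal is a disjoint union of q translates of the next one, all of the same measure. *)
Lemma mu_pideal_step n :
  mu (pideal n) = ((residue_card F)%:R%:E * mu (pideal (n + 1)))%E.
Proof.
have [w w0 w1] := @lval_surj F; have hw : is_uniformizer w by [].
rewrite (pideal_cosets hw n).
have mC (C : set F) : vcosets (@lval F) C ->
   measurable (scale_set (w ^ n) C : set (borelF F)) /\
   mu (scale_set (w ^ n) C) = mu (pideal (n + 1)).
  move=> [x _ <-]; rewrite scale_coset//.
  (* Invariance is stated for preimages under translations, so the coset is put in that form. *)
  have e : [set w ^ n * x + y | y in pideal (n + 1)] =
      translate (- (w ^ n * x)) @^-1` (pideal (n + 1)).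
    apply/seteqP; split=> [_ [y yn <-]|y yn]; rewrite /preimage/= /translate.
      by rewrite addrAC subrr add0r.
    by exists (y - w ^ n * x) => //; rewrite addrC subrK.
  split; last by rewrite e mu_translate//; exact: measurable_pideal.
  rewrite e -[_ @^-1` _]setTI; apply: measurable_translate => //.
  exact: measurable_pideal.
rewrite measure_fin_bigcup.
- rewrite fsbig_finite/=; last exact: lval_finite.
  rewrite (eq_big_seq (fun _ => mu (pideal (n + 1)))).
    by rewrite big_const_seq count_predT iter_addr_0 mule_natl.
  by move=> C; rewrite in_fset_set ?inE; [move/mC => []|exact: lval_finite].
- exact: lval_finite.
- exact: trivIset_scale_cosets.
- by move=> C /mC[].
Qed.

Lemma mu_pidealN (k : nat) : mu (pideal (- k%:Z)) = ((residue_card F)%:R ^+ k)%:E.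
Proof.
elim: k => [|k IH]; first by rewrite oppr0 expr0.
rewrite mu_pideal_step (_ : - k.+1%:Z + 1 = - k%:Z); last lia.
by rewrite IH exprS EFinM.
Qed.

End Haar.

Lemma norm1_Re_Im (R : realType) (z : R[i]) : `|z| = 1 ->
  `|complex.Re z| <= 1 /\ `|complex.Im z| <= 1.
Proof.
case: z => a b; rewrite normc_def /= => /complexI e.
have s1 : a ^+ 2 + b ^+ 2 = 1.
  by rewrite -[LHS]sqr_sqrtr ?addr_ge0 ?sqr_ge0// e expr1n.
split; rewrite -(@ler_pXn2r _ 2)// ?nnegrE ?normr_ge0// expr1n real_normK ?num_real//.
  by rewrite -s1 lerDl sqr_ge0.
by rewrite -s1 lerDr sqr_ge0.
Qed.

(** * Characters integrated over a box *)

Section BoxIntegral.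
Variables (F : naLocalFieldType) (R : realType) (psi : F -> R[i]).
Hypothesis hpsi : is_character psi.
Variable mu : {sigma_finite_measure set (borelF F) -> \bar R}.
Hypothesis hmu : is_haar (fun y x : pointed_lfield F => (x + y : F)) mu.
Hypothesis hmu1 : mu lint = 1%E.
Local Notation F4 := (borelF F * borelF F * borelF F * borelF F)%type.
Local Notation mu4 := (mu \x mu \x mu \x mu)%E.
Variables (n1 n2 n3 n4 : int) (l1 l2 : F).

Definition pbox : set F4 :=
  (pideal n1 : set (borelF F)) `*` (pideal n2 : set (borelF F))
  `*` (pideal n3 : set (borelF F)) `*` (pideal n4 : set (borelF F)).

Lemma measurable_pbox : measurable pbox.
Proof.
have m n := @measurable_pideal F n.
by do ?apply: measurableX.
Qed.

Lemma mu_pbox : mu4 pbox =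
  (mu (pideal n1) * mu (pideal n2) * mu (pideal n3) * mu (pideal n4))%E.
Proof.
have m n := @measurable_pideal F n.
have m12 := measurableX (m n1) (m n2); have m123 := measurableX m12 (m n3).
apply: etrans; first exact: product_measure1E.
congr (_ * _)%E; apply: etrans; first exact: product_measure1E.
congr (_ * _)%E; exact: product_measure1E.
Qed.

Lemma mu_pbox_fin : (mu4 pbox < +oo)%E.
Proof.
have fin n : mu (pideal n) \is a fin_num by rewrite ge0_fin_numE// mu_pideal_fin.
by rewrite mu_pbox -ge0_fin_numE ?mule_ge0// !fin_numM.
Qed.

(** The function is constant on cosets of an ideal, so [S] can be arbitrary. Hence every real
    function of its values is measurable. *)
Lemma open_psi_preimage (l : F) (S : set R[i]) : open [set x | S (psi (l * x))].
Proof.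
rewrite openE => x /= xS; apply/nbhs_pidealP.
exists (- lval l) => y yx /=; rewrite -(subrK x y) mulrDr psiD//.
rewrite psi_lint ?mul1r//.
by have := pidealM (pideal_lval l) yx; rewrite subrr.
Qed.

Lemma measurable_psi (l : F) (h : R[i] -> R) :
  measurable_fun setT (fun x : borelF F => h (psi (l * x))).
Proof.
move=> _ S mS; rewrite setTI; apply: measurable_open.
exact: (open_psi_preimage l (h @^-1` S)).
Qed.

Definition box_psi (p : F4) : R[i] :=
  if `[< pbox p >] then psi (l1 * (p.1.1.1 : F) + l2 * (p.2 : F)) else 0.

(** The integrand is bounded by 1 in absolute value and supported on a box of finite volume. *)
Lemma cintegrable_box_psi : cintegrable mu4 box_psi.
Proof.
pose h (p : F4) := psi (l1 * (p.1.1.1 : F) + l2 * (p.2 : F)).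
(* Splitting the character reduces measurability on the product to one coordinate at a time. *)
have hE (p : F4) : h p = psi (l1 * (p.1.1.1 : F)) * psi (l2 * (p.2 : F)).
  exact: psiD.
have m1 (k : R[i] -> R) : measurable_fun setT
    (fun p : F4 => k (psi (l1 * (p.1.1.1 : F)))).
  apply: (measurableT_comp (measurable_psi l1 k)).
  by do 2!apply: measurableT_comp => //.
have m2 (k : R[i] -> R) : measurable_fun setT
    (fun p : F4 => k (psi (l2 * (p.2 : F)))).
  exact: (measurableT_comp (measurable_psi l2 k)).
have mRe : measurable_fun setT (fun p => complex.Re (h p)).
  rewrite (_ : (fun _ => _) = fun p : F4 =>
    complex.Re (psi (l1 * (p.1.1.1 : F))) * complex.Re (psi (l2 * (p.2 : F))) -
    complex.Im (psi (l1 * (p.1.1.1 : F))) * complex.Im (psi (l2 * (p.2 : F)))).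
    by apply: measurable_funB; apply: measurable_funM.
  by apply/funext => p; rewrite hE; case: (psi _) => ? ?; case: (psi _).
have mIm : measurable_fun setT (fun p => complex.Im (h p)).
  rewrite (_ : (fun _ => _) = fun p : F4 =>
    complex.Re (psi (l1 * (p.1.1.1 : F))) * complex.Im (psi (l2 * (p.2 : F))) +
    complex.Im (psi (l1 * (p.1.1.1 : F))) * complex.Re (psi (l2 * (p.2 : F)))).
    by apply: measurable_funD; apply: measurable_funM.
  by apply/funext => p; rewrite hE; case: (psi _) => ? ?; case: (psi _).
have key (k : R[i] -> R) : k 0 = 0 -> measurable_fun setT (fun p => k (h p)) ->
    (forall p, `|k (h p)| <= 1) ->
    mu4.-integrable setT (fun p => (k (box_psi p))%:E).
  move=> k0 mk k1.
  rewrite (_ : (fun _ => _) = (EFin \o (fun p => k (h p))) \_ pbox); last first.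
    apply/funext => p; rewrite /patch /box_psi.
    by case: asboolP => hp; [rewrite mem_set|rewrite memNset// k0].
  apply/(integrable_mkcond _ measurable_pbox).
  apply: measurable_bounded_integrable.
  - exact: measurable_pbox.
  - exact: mu_pbox_fin.
  - exact: measurable_funTS.
  - exists 1; split; first exact: num_real.
    by move=> M M1 p _ /=; apply: le_trans (k1 p) (ltW M1).
have n1h p : `|h p| = 1 by exact: norm_psi.
by split; apply: key => // p; have [] := norm1_Re_Im (n1h p).
Qed.

(** Translation by (y1, 0, 0, y4) preserves the box and multiplies the integrand by a constant
    different from 1, so the integral equals that constant times itself. *)
Lemma cintegral_box_psi_eq0 (y1 y4 : F) : pideal n1 y1 -> pideal n4 y4 ->
  psi (l1 * y1 + l2 * y4) != 1 -> cintegral mu4 box_psi = 0.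
Proof.
move=> hy1 hy4 hy.
have invid A : measurable A -> mu (id @^-1` A) = mu A by [].
have inv y := mu_translate hmu y.
(* The translation is built one coordinate at a time, with the identity on the second and third. *)
have [mT2 invT2] := product_measure_invariant (@measurable_translate F y1)
  (@measurable_id _ (borelF F) setT) (inv y1) invid.
have [mT3 invT3] := product_measure_invariant (m1 := (mu \x mu)%E) (m2 := mu)
  mT2 (@measurable_id _ (borelF F) setT) invT2 invid.
have [mT4 invT4] := product_measure_invariant (m1 := (mu \x mu \x mu)%E) (m2 := mu)
  mT3 (@measurable_translate F y4) invT3 (inv y4).
set T := (fun x => _) in mT4 invT4.
have fT : box_psi \o T = fun p => psi (l1 * y1 + l2 * y4) * box_psi p.
  apply/funext => -[[[x y] z] v] /=; rewrite /box_psi /T /translate /=.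
  have pT n (p r : F) : pideal n r -> pideal n (p + r) <-> pideal n p.
    move=> hr; split=> [h|h]; last exact: pidealD.
    by rewrite -(addrK r p); exact: pidealB.
  have -> : `[< pbox (((x : F) + y1 : F), y, z, ((v : F) + y4 : F)) >] =
      `[< pbox (x, y, z, v) >].
    apply: asbool_equiv_eq; rewrite /pbox /=; split=> -[[[/= h1 h2] h3] h4].
      by do !split => //=; [exact/(pT _ _ _ hy1)|exact/(pT _ _ _ hy4)].
    by do !split => //=; [exact/(pT _ _ _ hy1)|exact/(pT _ _ _ hy4)].
  case: asboolP => _; last by rewrite mulr0.
  by rewrite -psiD//; congr psi; ring.
have int_box := cintegrable_box_psi.
have intT : cintegrable mu4 (box_psi \o T).
  rewrite fT; exact: cintegrableZ.
have := cintegral_invariant mT4 invT4 int_box intT.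
rewrite fT cintegralZ// => /eqP; rewrite -subr_eq0 -{2}[cintegral _ _]mul1r -mulrBl.
by rewrite mulf_eq0 subr_eq0 (negPf hy) => /eqP.
Qed.

Lemma cintegral_box_psi : (forall y, pideal n1 y -> psi (l1 * y) = 1) ->
    (forall y, pideal n4 y -> psi (l2 * y) = 1) ->
  cintegral mu4 box_psi = (fine (mu4 pbox))%:C%C.
Proof.
move=> h1 h4; rewrite -[RHS]mul1r -cintegral_indic; last exact: measurable_pbox.
congr cintegral; apply/funext => p; rewrite /box_psi; case: asboolP => //.
by move=> [[[p1 _] _] p4]; rewrite psiD// h1// h4// mul1r.
Qed.

End BoxIntegral.

(** * The integral over U *)

Section MatrixCoefficients.
Variables (R : realType) (F : naLocalFieldType) (w : F) (psi : F -> R[i]).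
Hypotheses (hw : is_uniformizer w) (hpsi : is_character psi).
Variable mu : {sigma_finite_measure set (borelF F) -> \bar R}.
Hypothesis hmu : is_haar (fun y x : pointed_lfield F => (x + y : F)) mu.
Hypothesis hmu1 : mu lint = 1%E.
Variable nu : {measure set (borel (ZG F)) -> \bar R}.
Hypothesis hnu : is_haar (@ZGtrans F) nu.
Variables (t : F) (s : bool) (c1 c2 : F).
Hypotheses (ht : lunit t) (hc1 : lunit c1) (hc2 : lunit c2).
Local Notation f := (fmin psi w t s).
Local Notation J := (J0 psi w t nu mu c1 c2).

Lemma rtransM (g h : GSp4 F) (v : GSp4 F -> R[i]) :
  rtrans g (rtrans h v) = rtrans (g * h)%g v.
Proof. by apply/funext => x; rewrite /rtrans mulgA. Qed.

Lemma fmin1 : f 1%g = 1.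
Proof.
rewrite fmin_normalized//=; try by rewrite mxE.
rewrite asboolT; last exact: Kp1.
by rewrite /ell /= !mxE /= mulr0 !addr0 /psi0 mulr0 (psi0E hpsi).
Qed.

Lemma inner_torus (a b : F) :
  inner w t nu (rtrans (dmat a b) f) (rtrans (dmat a b) f) = 1.
Proof.
by rewrite inner_rtrans// mulVg ?fmin1// => _; apply: Hgrp_Kp; exact: Kp1.
Qed.

Section Torus.
Variables (a b g d : F).
Hypotheses (ha : a != 0) (hb : b != 0) (hg : g != 0) (hd : d != 0).

Lemma inner_dud x y z v :
  inner w t nu (rtrans (umat x y z v) (rtrans (dmat a b) f)) (rtrans (dmat g d) f)
  = f (dud a b g d x y z v).
Proof.
rewrite rtransM inner_rtrans//; apply: upper_Hgrp => //.
by rewrite -[(_ * _)%g]/(dud a b g d x y z v) dudE// mxE.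
Qed.

Lemma J0_dud_eq0 : ~ (lunit1 (a / g) /\ lunit1 (b / d)) ->
  J (rtrans (dmat a b) f) (rtrans (dmat g d) f) = 0.
Proof.
move=> h; rewrite /J0.
(* The zero integrand is presented as a multiple of the indicator of the empty set. *)
rewrite (_ : (fun _ => _) = fun p => if `[< set0 p >] then 0 else 0).
  by rewrite cintegral_indic ?mul0r.
apply/funext => -[[[x y] z] v]; rewrite inner_dud fmin_dud_eq0// mul0r.
by case: ifP.
Qed.

(** Dividing by the character of U shifts the two frequencies of [fmin_dud] by [c1] and [c2]. *)
Lemma J0_dud : lunit1 (a / g) -> lunit1 (b / d) ->
  J (rtrans (dmat a b) f) (rtrans (dmat g d) f) =
  cintegral (mu \x mu \x mu \x mu)%E
    (box_psi psi (lval g) (lval (g * d)) (lval (g ^+ 2 * d)) (lval d)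
       (w^-1 / g - c1) (w^-1 / d - c2)).
Proof.
move=> hag hbd; rewrite /J0; congr cintegral.
apply/funext => -[[[x y] z] v]; rewrite inner_dud fmin_dud// /box_psi /=.
rewrite -[pbox _ _ _ _ _]/(box g d (x, y, z, v)).
case: asboolP => _; last by rewrite mul0r.
by rewrite -psiN// -psiD//; congr psi; ring.
Qed.

End Torus.

(** The frequency is -(w c g - 1) times w^-1/g, whose valuation is -1 - v(g), so both sides say that
    w c g is in 1 + p. The right side means that the frequency carries p^(v(g)) into the
    integers. *)
Lemma support_pideal (c g : F) : lunit c -> g != 0 ->
  [set w^-1 * c^-1 * y | y in lunit1] g <-> pideal (- lval g) (w^-1 / g - c).
Proof.
have [w0 w1] := hw; move=> [c0 vc] g0.
have -> : w^-1 / g - c = - (w * c * g - 1) * (w^-1 / g) by field; rewrite g0 w0.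
rewrite pidealMr ?mulf_neq0 ?invr_neq0// lvalM ?invr_neq0// !lvalV// w1.
rewrite (_ : - lval g - _ = 1); last lia.
rewrite pidealN -lunit1P; split=> [[y hy <-]|h].
  by rewrite (_ : _ * _ = y)//; field; rewrite w0 c0.
by exists (w * c * g) => //; field; rewrite w0 c0.
Qed.

Lemma lval_support (c g : F) : lunit c ->
  [set w^-1 * c^-1 * y | y in lunit1] g -> lval g = -1.
Proof.
have [w0 w1] := hw; move=> [c0 vc] [y hy <-].
have y0 := lunit1_neq0 hy.
by rewrite !lvalM ?mulf_neq0 ?invr_neq0// !lvalV// w1 vc lval_lunit1//.
Qed.

(** Outside the support the frequency is nonzero, with valuation less than [- lval g], so
    [psi_pideal_neq1] applies. *)
Lemma psi_not_support (c g : F) : lunit c -> g != 0 ->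
  ~ [set w^-1 * c^-1 * y | y in lunit1] g ->
  exists2 y, pideal (lval g) y & psi ((w^-1 / g - c) * y) != 1.
Proof.
move=> hc g0 /(support_pideal hc g0) h; apply: psi_pideal_neq1 => //.
  by apply/eqP => e; apply: h; rewrite e; left.
by rewrite ltNge; apply/negP => le0; apply: h; right; lia.
Qed.

Lemma psi_support (c g : F) : lunit c -> g != 0 ->
  [set w^-1 * c^-1 * y | y in lunit1] g ->
  forall y, pideal (lval g) y -> psi ((w^-1 / g - c) * y) = 1.
Proof.
move=> hc g0 /(support_pideal hc g0) h y hy; apply: psi_lint => //.
by have := pidealM h hy; rewrite addNr.
Qed.

Section Values.
Variables (a b g d : F).
Hypotheses (ha : a != 0) (hb : b != 0) (hg : g != 0) (hd : d != 0).

Lemma J0_off_support : ~ J0_support w c1 c2 a b g d ->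
  J (rtrans (dmat a b) f) (rtrans (dmat g d) f) = 0.
Proof.
move=> ns; have [[hag hbd]|h] := pselect (lunit1 (a / g) /\ lunit1 (b / d)); last first.
  exact: J0_dud_eq0.
rewrite J0_dud//.
have [sg|/(psi_not_support hc1 hg)[y hy py]] :=
    pselect ([set w^-1 * c1^-1 * y | y in lunit1] g); last first.
  (* Only the coordinate carrying the nontrivial character is shifted. *)
  apply: (@cintegral_box_psi_eq0 _ _ _ hpsi _ hmu _ _ _ _ _ _ y 0) => //.
  by rewrite mulr0 addr0.
have [sd|/(psi_not_support hc2 hd)[y hy py]] :=
    pselect ([set w^-1 * c2^-1 * y | y in lunit1] d); last first.
  apply: (@cintegral_box_psi_eq0 _ _ _ hpsi _ hmu _ _ _ _ _ _ 0 y) => //.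
  by rewrite mulr0 add0r.
by case: ns.
Qed.

Lemma J0_on_support : J0_support w c1 c2 a b g d ->
  J (rtrans (dmat a b) f) (rtrans (dmat g d) f) = (residue_card F)%:R ^+ 7.
Proof.
move=> [hag hbd sg sd]; rewrite J0_dud// cintegral_box_psi//; first last.
- exact: psi_support.
- exact: psi_support.
have vg := lval_support hc1 sg; have vd := lval_support hc2 sd.
(* With valuation -1 for both [g] and [d], the exponents are -1, -2, -3, -1, and the volumes
   multiply to q^(1+2+3+1). *)
rewrite mu_pbox// !lvalM ?mulf_neq0// vg vd.
have -> : -1 + -1 + -1 = - 3%:Z by [].
have -> : -1 + -1 = - 2%:Z by [].
have -> : -1 = - 1%:Z by [].
rewrite !mu_pidealN// -!EFinM /= -!exprD.
by rewrite rmorphXn rmorph_nat.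
Qed.

End Values.
End MatrixCoefficients.

Theorem proposition3p2 (R : realType) (F : naLocalFieldType) (w : F)
    (hw : is_uniformizer w)
    (psi : F -> R[i]) (hpsi : is_character psi)
    (* the Haar measure on F *)
    (mu : {sigma_finite_measure set (borelF F) -> \bar R})
    (hmu : is_haar (fun y x : pointed_lfield F => (x + y : F)) mu)
    (hmu1 : mu lint = 1%E)
    (* a Haar measure on Z\G *)
    (nu : {measure set (borel (ZG F)) -> \bar R})
    (hnu : is_haar (@ZGtrans F) nu)
    (t : F) (ht : lunit t)
    (* the sign of chi^+-, f_min^+- *)
    (s : bool)
    (c1 c2 : F) (hc1 : lunit c1) (hc2 : lunit c2)
    (a b g d : F) (ha : a != 0) (hb : b != 0) (hg : g != 0) (hd : d != 0) :
  let f := fmin psi w t s in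
  let J (v1 v2 : GSp4 F -> R[i]) := J0 psi w t nu mu c1 c2 v1 v2 in
  let q : R[i] := (residue_card F)%:R in
  [/\ ~ J0_support w c1 c2 a b g d ->
        J (rtrans (dmat a b) f) (rtrans (dmat g d) f) = 0,
      J0_support w c1 c2 a b g d ->
        J (rtrans (dmat a b) f) (rtrans (dmat g d) f) = q ^+ 7
    & J0norm psi w t nu mu c1 c2
        (rtrans (dmat (w^-1 * c1^-1) (w^-1 * c2^-1)) f) = q ^+ 7].
Proof.
move=> f J q; split; [exact: J0_off_support|exact: J0_on_support|].
have [w0 _] := hw; have [c10 _] := hc1; have [c20 _] := hc2.
(* The vector has norm 1, so the normalized integral is [J0] at equal arguments, where both ratios
   are 1. *)
rewrite /J0norm inner_torus// divr1 J0_on_support ?mulf_neq0 ?invr_neq0//.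
split; rewrite ?divff ?mulf_neq0 ?invr_neq0//; try exact: lunit1_one.
  by exists 1; [exact: lunit1_one|rewrite mulr1].
by exists 1; [exact: lunit1_one|rewrite mulr1].
Qed.
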